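(* There exist absolute constants $c_1,c_2>0$ such that for every prime $p$ and every positive integer $k$, with $n=p^k$, \[c_1\, p^{\frac{k-\lfloor k/3\rfloor}{2}}\le \operatorname{disc}(\mathcal A_n)\le c_2\, p^{\frac{k-\lfloor k/3\rfloor}{2}};\] equivalently $\operatorname{disc}(\mathcal A_n)=\Theta\big(n^{\frac13+\frac{r_k}{6k}}\big)$, where $r_k\in\{0,1,2\}$ is the remainder of $k$ modulo $3$.
   Context: For a positive integer $n$, an arithmetic progression in $\mathbb{Z}_n$ is a set $\{a+kd: 0\le k<l\}$ with $a,d\in\mathbb{Z}_n$ and $l$ an integer with $0\le l\le n/\gcd(n,d)$ (here $\gcd(d,n)$ is computed for any integer representative of $d$, so $\gcd(0,n)=n$). $\mathcal A_n$ denotes the family of all arithmetic progressions in $\mathbb{Z}_n$. For $\chi:\mathbb{Z}_n\to\{1,-1\}$ and $A\subseteq\mathbb{Z}_n$, $\chi(A)=\sum_{x\in A}\chi(x)$, and $\operatorname{disc}(\mathcal A_n)=\min_{\chi:\mathbb{Z}_n\to\{1,-1\}}\max_{A\in\mathcal A_n}|\chi(A)|$. *)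

(* Defs.v *)
From mathcomp Require Import all_boot all_order all_algebra.
Set Implicit Arguments. Unset Strict Implicit. Unset Printing Implicit Defensive.
Import Order.TTheory GRing.Theory Num.Theory.

(* Z_n is represented by 'I_n (residues 0..n-1, arithmetic mod n). *)

Definition ap (n : nat) (a d l : nat) : {set 'I_n} :=
  [set x : 'I_n | [exists i : 'I_n.+1, (i < l) && (val x == (a + i * d) %% n)]].

(* Admissible parameters: a, d in Z_n and 0 <= l <= n / gcd(n, d)
   (gcdn 0 n = n).  Since l <= n, l ranges over 'I_n.+1. *)
Definition ap_ok (n : nat) (d : 'I_n) (l : 'I_n.+1) : bool :=
  (val l <= n %/ gcdn d n).

Definition chi_sum (n : nat) (chi : {ffun 'I_n -> bool}) (A : {set 'I_n}) : int :=
  \sum_(x in A) (if chi x then 1 else -1)%R.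

Definition ap_disc_of (n : nat) (chi : {ffun 'I_n -> bool}) : nat :=
  \max_(adl : 'I_n * 'I_n * 'I_n.+1 | ap_ok adl.1.2 adl.2)
     `|chi_sum chi (ap n adl.1.1 adl.1.2 adl.2)|%N.

Definition disc_AP (n : nat) : nat :=
  ap_disc_of [arg min_(chi < [ffun _ => true] : {ffun 'I_n -> bool}) ap_disc_of chi].

(* Main.v *)
Require Import Defs.
From mathcomp Require Import all_boot all_order all_algebra.
From mathcomp Require Import all_reals.
From mathcomp Require Import sequences exp.
From mathcomp Require Import zify ring lra.
Import Order.TTheory GRing.Theory Num.Theory.
Local Open Scope ring_scope.
Set Implicit Arguments.
Unset Strict Implicit.
Unset Printing Implicit Defensive.

(* Write n = p^k, l = floor(k/3) and D for the discrepancy of a colouring chi.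

   Lower bound. Put M = p^(k-l-1) and P = p^(l+1) = n/M. The cosets of M Z_n are
   progressions of length P and P >= p^((k-l)/2), so one may assume 2D <= P. Subtract
   from P chi its coset sums: F has |F| >= P/2, vanishing sums on the cosets of M Z_n, and
   sums at most 2PD on progressions of unit difference. Expand the sum of the squares
   of F(a + {0,...,L-1} d) over all a and all units d, i.e. over all d minus the
   multiples of p. Each correlation summed over all d is nonnegative; summed over the
   multiples of p it vanishes unless M divides i - j, and otherwise it is a fraction 1/p of
   the trivial bound. With L about Mp/64 the diagonal dominates, so D^2 >> L >> p^(k-l).

   Upper bound. Take chi periodic modulo N = p^(k-l). A progression in Z_n then wraps at
   most p^l <= sqrt N times around a cycle of Z_N, which is a residue class modulo some
   p^j, so it suffices to colour Z_N with sums O(1) on these classes and O(sqrt N) on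
   shorter progressions. List Z_N by reversing base p digits: the classes become intervals,
   and giving opposite colours to the positions 2i and 2i+1 bounds their sums by 2. The
   signs of the pairs are found by repeated partial colouring. For each d, the cycles of
   translation by d form a linear order of Z_N; these N orders are cut into dyadic
   intervals, and a pigeonhole over the rounded interval sums, with exponential weights
   and the fourth moment as only probabilistic input, gives two colourings that agree on
   all rounded sums and differ on a positive proportion of the pairs. *)

(** * The lower bound *)

Lemma sum_const_pred (R : pzRingType) (T : finType) (A : pred T) (c : R) :
  \sum_(i | A i) c = #|A|%:R * c.
Proof. by rewrite mulr_natl -sumr_const. Qed.

(** Serves the choice w = max(1, p/64) in [lower_core]: the first bound keeps the w - 1 off-diagonal
    terms of a row below the diagonal one, the second makes M w at least p^(k-l)/128. For p < 128
    one has w = 1 and a row has no such terms. *)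
Lemma maxn_div64 p :
  ((maxn 1 (p %/ 64)).-1 * 64 <= p)%N /\ (p <= 128 * maxn 1 (p %/ 64))%N.
Proof.
by have := leq_trunc_div p 64; have := ltn_ceil p (isT : 0 < 64)%N; lia.
Qed.

Section CosetCorrelation.
Variables (R : realFieldType) (m : nat).
Notation n := (m.+2).
Notation Zn := ('I_m.+2).
Implicit Types (F : Zn -> R) (h : Zn).

Lemma val_natmul (a : Zn) i : val (a *+ i) = ((i * a) %% n)%N.
Proof.
elim: i => [|i IH]; first by rewrite mulr0n mul0n mod0n.
by rewrite mulrS /= IH modnDmr mulSn.
Qed.

Lemma corr_shift F (x y : Zn) :
  \sum_a F (a + x) * F (a + y) = \sum_a F a * F (a + (y - x)).
Proof.
rewrite [RHS](reindex_inj (addIr x)); apply: eq_bigr => a _.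
by rewrite -addrA [x + _]addrC subrK.
Qed.

(* Averaging over the translations [a -> a + h * e] turns the sum into a sum of squares. *)
Lemma corr_all_ge0 F h : 0 <= \sum_d \sum_a F a * F (a + h * d).
Proof.
have E : n%:R * (\sum_d \sum_a F a * F (a + h * d)) =
    \sum_a (\sum_e F (a + h * e)) ^+ 2.
  transitivity (\sum_(e : Zn) \sum_d \sum_a F (a + h * e) * F (a + h * d)).
    rewrite -{1}(card_ord n) -sum1_card natr_sum mulr_suml.
    apply: eq_bigr => e _; rewrite mul1r.
    rewrite [RHS](reindex_inj (addIr e)); apply: eq_bigr => d _.
    by rewrite corr_shift -mulrBr addrK.
  under eq_bigr do rewrite exchange_big /=.
  rewrite exchange_big /=; apply: eq_bigr => a _.
  rewrite expr2 mulr_suml; apply: eq_bigr => e _.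
  by rewrite mulr_sumr.
rewrite -(@pmulr_rge0 _ n%:R) ?ltr0n // E.
by apply: sumr_ge0 => a _; exact: sqr_ge0.
Qed.

Variables p k l : nat.
Hypotheses (pp : prime p) (hn : n = (p ^ k)%N) (lk : (l < k)%N).
Notation M := (p ^ (k - l - 1))%N.
Notation P := (p ^ l.+1)%N.

Let MP : (M * P = n)%N.
Proof. by rewrite hn -expnD; congr (_ ^ _)%N; lia. Qed.

Let M0 : (0 < M)%N. Proof. by rewrite expn_gt0 prime_gt0. Qed.
Let P0 : (0 < P)%N. Proof. by rewrite expn_gt0 prime_gt0. Qed.
Let pn : (p %| n)%N. Proof. by rewrite hn dvdn_exp //; lia. Qed.

Lemma natZn_eq0 i : (n %| i)%N -> (i%:R : Zn) = 0.
Proof.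
by move=> hi; apply/val_inj; rewrite /= val_natmul; apply/eqP/dvdn_mulr.
Qed.

Lemma natr_valZn h : (val h)%:R = h.
Proof.
have v1 : val (1 : Zn) = 1%N by [].
by apply/val_inj; rewrite /= val_natmul v1 muln1 modn_small.
Qed.

(** The gcd of n and h is p^v with v < k-l-1, and Bezout makes p^v a multiple of h modulo n. As M is
    a larger power of p, a factor p is left over. *)
Lemma solve_coset h : ~~ (M %| h)%N -> exists e : Zn, h * (p%:R * e) = M%:R.
Proof.
move=> Mh; have [v hv] : exists v, gcdn n h = (p ^ v)%N.
  have : (gcdn n h %| p ^ k)%N by rewrite -hn dvdn_gcdl.
  by case/(dvdn_pfactor _ _ pp) => v _ ->; exists v.
have vk : (v < k - l - 1)%N.
  rewrite ltnNge; apply: contra Mh => le; apply: dvdn_trans (dvdn_gcdr n h).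
  by rewrite hv dvdn_exp2l.
have [a _ /natZn_eq0] := @Bezoutl n h isT.
rewrite hv natrD natrM natr_valZn => /eqP; rewrite addr_eq0 => /eqP E.
exists (- (a%:R * (p ^ (k - l - 1 - v - 1))%:R)).
have -> : M%:R = (p%:R * (p ^ (k - l - 1 - v - 1))%:R) * (p ^ v)%:R :> Zn.
  by rewrite -!natrM -expnS -expnD; congr (_ %:R); congr expn; lia.
by rewrite E; ring.
Qed.

Definition pdiv_dirs : pred Zn := fun d => (p %| d)%N.

Lemma pdiv_dirs_shift (d e : Zn) : pdiv_dirs (d + p%:R * e) = pdiv_dirs d.
Proof.
rewrite /pdiv_dirs; have H i : (p %| i %% n)%N = (p %| i)%N.
  by rewrite {2}(divn_eq i n) dvdn_addr // dvdn_mull.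
have -> : val (d + p%:R * e) = ((d + (p * e) %% n) %% n)%N.
  by rewrite -val_natmul mulr_natl.
by rewrite H dvdn_addl // H dvdn_mulr.
Qed.

(** With e from [solve_coset], translating d by s p e permutes the multiples of p and moves a + h d
    by s M. Averaging over s < P produces coset sums, which vanish. *)
Lemma corr_pdiv_eq0 F h a : (forall x, \sum_(s < P) F (x + M%:R *+ s) = 0) ->
  ~~ (M %| h)%N -> \sum_(d | pdiv_dirs d) F (a + h * d) = 0.
Proof.
move=> F0 /solve_coset[e he].
have S s : \sum_(d | pdiv_dirs d) F (a + h * d) =
    \sum_(d | pdiv_dirs d) F (a + h * d + M%:R *+ s).
  rewrite (reindex_inj (addIr (p%:R * (e *+ s)))).
  apply: eq_big => d; first by rewrite pdiv_dirs_shift.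
  by move=> _; rewrite mulrDr mulrnAr mulrnAr he addrA.
have : P%:R * (\sum_(d | pdiv_dirs d) F (a + h * d)) = 0.
  rewrite -{1}(card_ord P) -sum1_card natr_sum mulr_suml.
  under eq_bigr => s _ do rewrite mul1r (S s).
  by rewrite exchange_big big1.
by move/eqP; rewrite mulf_eq0 pnatr_eq0 eqn0Ngt P0 /= => /eqP.
Qed.

Lemma card_pdiv_dirs : (p * #|pdiv_dirs| <= n)%N.
Proof.
rewrite mulnC -leq_divRL ?prime_gt0 //.
have dlt (d : Zn) : pdiv_dirs d -> (d %/ p < n %/ p)%N.
  by move=> _; rewrite ltn_divLR ?prime_gt0 // divnK.
pose g (d : Zn) : 'I_((n %/ p).-1.+1) := inord (d %/ p).
have np : (0 < n %/ p)%N by rewrite divn_gt0 ?prime_gt0 // dvdn_leq.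
have gi : {in pdiv_dirs &, injective g}.
  move=> d d' hd hd' /(congr1 val); rewrite /= !inordK ?prednK ?dlt //.
  move=> E; apply/val_inj.
  by rewrite /= -(divnK (hd : p %| d)%N) -(divnK (hd' : p %| d')%N) E.
by have := leq_card_in _ _ gi; rewrite card_ord prednK.
Qed.

Lemma card_ord_modn (w : nat) (r : nat) :
  (#|[pred i : 'I_(M * w) | i == r %[mod M]]| <= w)%N.
Proof.
have ilt (i : 'I_(M * w)) : (i %/ M < w)%N by rewrite ltn_divLR // [ltnRHS]mulnC.
pose g i := Ordinal (ilt i).
have gi : {in [pred i : 'I_(M * w) | i == r %[mod M]] &, injective g}.
  move=> i j /eqP hi /eqP hj /(congr1 val) /= E; apply/val_inj.
  by rewrite /= (divn_eq i M) (divn_eq j M) E hi hj.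
by have := leq_card_in _ _ gi; rewrite card_ord.
Qed.

Lemma sum_sqr_expand F (L : nat) (D : pred Zn) :
  \sum_(d | D d) \sum_a (\sum_(i < L) F (a + d *+ i)) ^+ 2 =
  \sum_(i < L) \sum_(j < L) \sum_(d | D d) \sum_a F a * F (a + (j%:R - i%:R) * d).
Proof.
transitivity (\sum_(d | D d) \sum_(i < L) \sum_(j < L)
    \sum_a F (a + d *+ i) * F (a + d *+ j)).
  apply: eq_bigr => d _; under [RHS]eq_bigr do rewrite exchange_big.
  rewrite [RHS]exchange_big; apply: eq_bigr => a _ /=.
  by rewrite expr2 mulr_suml; apply: eq_bigr => i _; rewrite mulr_sumr.
rewrite exchange_big; apply: eq_bigr => i _ /=.
rewrite exchange_big; apply: eq_bigr => j _ /=.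
apply: eq_bigr => d _; rewrite corr_shift; apply: eq_bigr => a _.
by rewrite mulrBl !mulr_natl.
Qed.

Lemma lower_core (chi : Zn -> R) (D : R) :
  (forall x, `|chi x| = 1) ->
  (forall (a d : Zn) L, (L <= n %/ gcdn d n)%N ->
     `|\sum_(i < L) chi (a + d *+ i)| <= D) ->
  2 * D <= P%:R -> (p ^ (k - l))%:R <= 8192 * D ^+ 2.
Proof.
move=> chi1 hD hP.
pose G x := \sum_(s < P) chi (x + M%:R *+ s).
pose F x := P%:R * chi x - G x.
have D0 : 0 <= D by apply: le_trans (hD 0 0 0%N isT); rewrite normr_ge0.
have vM : val (M%:R : Zn) = M.
  rewrite val_natmul muln1 modn_small // -[X in (_ < X)%N]MP ltn_Pmulr //.
  by rewrite -{1}(expn0 p) ltn_exp2l // prime_gt1.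
have GD x : `|G x| <= D.
  apply: hD; rewrite vM (_ : gcdn M n = M) -?[in X in (_ <= X)%N]MP ?mulKn //.
  by apply/gcdn_idPl; rewrite -[X in (_ %| X)%N]MP dvdn_mulr.
have GM x s : G (x + M%:R *+ s) = G x.
  elim: s x => [|s IH] x; first by rewrite mulr0n addr0.
  rewrite mulrSr addrA; transitivity (G (x + M%:R *+ s)); last exact: IH.
  move: (x + _) => {x IH} x; rewrite /G.
  (* A shift by M trades the first term of the coset sum for one displaced by M P = n, which is the
     same point. *)
  have -> : P = P.-1.+1 by rewrite prednK.
  rewrite big_ord_recr big_ord_recl /= addrC mulr0n addr0.
  congr (_ + _).
    rewrite -addrA -mulrS prednK // -mulrnA MP.
    by rewrite natZn_eq0 ?addr0.
  by apply: eq_bigr => i _; rewrite -addrA -mulrS.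
have F0 x : \sum_(s < P) F (x + M%:R *+ s) = 0.
  rewrite sumrB -mulr_sumr; under [X in _ - X]eq_bigr do rewrite GM.
  by rewrite sumr_const card_ord mulr_natl subrr.
have Pp : 0 < P%:R :> R by rewrite ltr0n.
have Pc x : `|P%:R * chi x| = P%:R by rewrite normrM chi1 mulr1 ger0_norm // ltW.
have Flo x : P%:R ^+ 2 / 4 <= F x * F x.
  have h : P%:R / 2 <= `|F x|.
    have := lerB_normD (P%:R * chi x) (- G x); rewrite Pc normrN.
    by have := GD x; lra.
  rewrite -expr2 -[leRHS]real_normK ?num_real //; nra.
have Fhi x : `|F x| <= 2 * P%:R.
  by have := ler_normB (P%:R * chi x) (G x); rewrite Pc; have := GD x; lra.
(* A unit difference admits every length up to n. The [chi] part contributes P D, and so does [G], a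
   sum over P translates of the progression. *)
have FAP a d L : ~~ pdiv_dirs d -> (L <= n)%N ->
    `|\sum_(i < L) F (a + d *+ i)| <= 2 * (P%:R * D).
  move=> nd Ln.
  have g1 : gcdn d n = 1%N.
    apply/eqP; rewrite [X in gcdn _ X]hn -/(coprime _ _) coprimeXr //.
    by rewrite coprime_sym prime_coprime.
  have H b : `|\sum_(i < L) chi (b + d *+ i)| <= D by apply: hD; rewrite g1 divn1.
  rewrite sumrB -mulr_sumr exchange_big /=.
  apply: le_trans (ler_normB _ _) _; rewrite mulr2n mulrDl mul1r lerD //.
    by rewrite normrM ger0_norm ?(ltW Pp) // ler_pM2l.
  apply: le_trans (ler_norm_sum _ _ _) _.
  rewrite -[P in P%:R * D]card_ord mulr_natl -sumr_const ler_sum // => s _.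
  by under eq_bigr do rewrite addrAC.
(* Each i < L has at most w - 1 other indices congruent to it modulo M. With (w - 1) 64 <= p their
   total loss (w - 1) 4U/p is at most U/16, half of the diagonal term U/8. *)
pose w := maxn 1 (p %/ 64); pose L := (M * w)%N.
have wp : (w <= p)%N by rewrite geq_max prime_gt0 //= leq_div.
have Ln : (L <= n)%N.
  rewrite -[X in (_ <= X)%N]MP leq_mul2l; apply/orP; right.
  by apply: leq_trans wp _; rewrite expnS leq_pmulr // expn_gt0 prime_gt0.
pose U : R := n%:R ^+ 2 * P%:R ^+ 2.
have U0 : 0 < U by rewrite mulr_gt0 // exprn_gt0 // ltr0n.
have p0 : 0 < p%:R :> R by rewrite ltr0n prime_gt0.
pose S := \sum_(d | ~~ pdiv_dirs d) \sum_a (\sum_(i < L) F (a + d *+ i)) ^+ 2.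
have Shi : S <= 4 * U * D ^+ 2.
  have -> : 4 * U * D ^+ 2 = \sum_(d : Zn) \sum_(a : Zn) (2 * (P%:R * D)) ^+ 2.
    rewrite !sum_const_pred card_ord /U.
    by move: (n%:R) (P%:R) => x y; ring.
  rewrite [leRHS](bigID pdiv_dirs) /= -[leLHS]add0r lerD //.
    by apply: sumr_ge0 => d _; apply: sumr_ge0 => a _; exact: sqr_ge0.
  apply: ler_sum => d nd; apply: ler_sum => a _.
  rewrite -[leLHS]real_normK ?num_real // ler_pXn2r ?nnegrE ?normr_ge0 ?FAP //.
  by rewrite !mulr_ge0 // ltW.
have cardp : #|pdiv_dirs|%:R * p%:R <= n%:R :> R.
  by rewrite -natrM ler_nat mulnC card_pdiv_dirs.
(* At least n/2 directions are prime to p, and each of the n starting points contributes at least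
   P^2/4. *)
have diag i : U / 8 <=
    \sum_(d | ~~ pdiv_dirs d) \sum_a F a * F (a + (i%:R - i%:R) * d).
  apply: (@le_trans _ _ (\sum_(d | ~~ pdiv_dirs d) \sum_(a : Zn) P%:R ^+ 2 / 4)).
    have cN : (#|pdiv_dirs| + #|[predC pdiv_dirs]|)%:R = n%:R :> R.
      by rewrite cardC card_ord.
    rewrite !sum_const_pred card_ord /U.
    rewrite -[X in _ <= X%:R * _]/(#|[predC pdiv_dirs]|).
    have p2 : 2 <= p%:R :> R by rewrite ler_nat prime_gt1.
    have x0 := ler0n R #|pdiv_dirs|; have n0 := ler0n R n.
    have P2 := sqr_ge0 (P%:R : R); move: cN; rewrite natrD.
    move: (#|pdiv_dirs|%:R : R) (#|[predC pdiv_dirs]|%:R : R) (n%:R : R)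
      (P%:R ^+ 2 : R) cardp x0 n0 P2.
    move=> x y z t xz x0 z0 t0 xyz; have yz : z / 2 <= y by nra.
    have zt : 0 <= z * t by rewrite mulr_ge0.
    rewrite mulrA; nra.
  apply: ler_sum => d _; apply: ler_sum => a _.
  by rewrite subrr mul0r addr0.
(* The sum over all directions is nonnegative, so the sum over units is at least minus that over the
   multiples of p: zero unless M divides j - i, else bounded by n/p directions, n points and |F|^2
   <= 4P^2. *)
have offd (i j : nat) : - (if j == i %[mod M] then 4 * U / p%:R else 0) <=
    \sum_(d | ~~ pdiv_dirs d) \sum_a F a * F (a + (j%:R - i%:R) * d).
  have aux (x y c : R) : 0 <= x + y -> x <= c -> - c <= y by lra.
  have := corr_all_ge0 F (j%:R - i%:R); rewrite (bigID pdiv_dirs) /=.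
  move/aux; apply.
  case: ifP => ji.
    apply: (@le_trans _ _ (\sum_(d | pdiv_dirs d) \sum_(a : Zn) 4 * P%:R ^+ 2)).
      apply: ler_sum => d _; apply: ler_sum => a _.
      apply: le_trans (ler_norm _) _; rewrite normrM.
      have -> : 4 * P%:R ^+ 2 = (2 * P%:R) * (2 * P%:R) :> R by ring.
      by rewrite ler_pM.
    rewrite !sum_const_pred card_ord ler_pdivlMr // /U.
    have n0 := ler0n R n; have P2 := sqr_ge0 (P%:R : R).
    move: (#|pdiv_dirs|%:R : R) (n%:R : R) (P%:R ^+ 2 : R) (p%:R : R) cardp n0 P2.
    move=> x z t q xqz z0 t0.
    have -> : x * (z * (4 * t)) * q = (x * q) * (4 * z * t) by ring.
    have -> : 4 * (z ^+ 2 * t) = z * (4 * z * t) by ring.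
    by rewrite ler_wpM2r // !mulr_ge0.
  rewrite exchange_big /= big1 // => a _; rewrite -mulr_sumr.
  rewrite corr_pdiv_eq0 ?mulr0 //; apply: contraFN ji => Mh.
  have Mn : (M %| n)%N by rewrite -[X in (_ %| X)%N]MP dvdn_mulr.
  have vn q : val (q%:R : Zn) = (q %% n)%N by rewrite val_natmul muln1.
  have vD (x y : Zn) : val (x + y) = ((val x + val y) %% n)%N by [].
  have := congr1 (fun x : Zn => val x %% M)%N (subrK (i%:R : Zn) j%:R).
  cbv beta; rewrite vD !vn !modn_dvdm // -modnDml (eqP Mh) add0n modn_dvdm //.
  by move=> ->.
have Slo : L%:R * (U / 16) <= S.
  rewrite /S sum_sqr_expand mulr_natl -[L in _ *+ L]card_ord -sumr_const.
  apply: ler_sum => i _; rewrite (bigD1 i) //=.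
  apply: (@le_trans _ _ (U / 8 - \sum_(j < L | j != i)
      if j == i %[mod M] then 4 * U / p%:R else 0)); last first.
    by rewrite lerD // -sumrN ler_sum.
  rewrite -big_mkcondr /= sum_const_pred.
  have : (#|[pred j : 'I_L | (j != i) && (j == i %[mod M])]| <= w.-1)%N.
    have w0 : (0 < w)%N by rewrite leq_max.
    rewrite -ltnS prednK //.
    have := card_ord_modn w i; rewrite (cardD1 i) inE eqxx add1n.
    by apply: leq_ltn_trans; apply/eq_leq/eq_card => j; rewrite !inE.
  rewrite -(ler_nat R); set c : R := (X in X <= _); move=> hc.
  rewrite -[X in X%:R * _]/(#|[pred j : 'I_L | (j != i) && (j == i %[mod M])]|) -/c.
  have w64 : (w.-1)%:R * 64 <= p%:R :> R.
    by rewrite -natrM ler_nat; case: (maxn_div64 p).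
  suff : c * (4 * U / p%:R) <= U / 16 by lra.
  rewrite mulrA ler_pdivrMr //; nra.
(* From L U/16 <= S <= 4 U D^2; the final constant is 8192 = 128 * 64. *)
have L64 : L%:R <= 64 * D ^+ 2.
  have := le_trans Slo Shi.
  have -> : L%:R * (U / 16) = (L%:R / 16) * U by ring.
  have -> : 4 * U * D ^+ 2 = (4 * D ^+ 2) * U by ring.
  by rewrite ler_pM2r //; lra.
have : (p ^ (k - l) <= 128 * L)%N.
  have -> : (k - l = k - l - 1 + 1)%N by rewrite subnK ?subn_gt0.
  rewrite expnD expn1 /L mulnCA leq_mul2l; apply/orP; right.
  by case: (maxn_div64 p).
by rewrite -(ler_nat R) natrM; lra.
Qed.

End CosetCorrelation.

(** * Partial colouring *)

Section RademacherMoments.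
Variables (R : realFieldType) (V : finType).
Notation Om := ({ffun V -> bool}).

Definition sg (b : bool) : R := if b then 1 else -1.

Definition flip (v : V) (A : Om) : Om := [ffun u => (u == v) (+) A u].

Lemma flipK v : involutive (flip v).
Proof. by move=> A; apply/ffunP => u; rewrite !ffunE addbA addbb. Qed.

(** Flipping the colour of [v] is an involution that negates every summand. *)
Lemma sum_sg_flip v (f : Om -> R) :
  (forall A, f (flip v A) = f A) -> \sum_A f A * sg (A v) = 0.
Proof.
move=> fv; set s := LHS; suff : s = - s by lra.
rewrite {1}/s (reindex_inj (inv_inj (flipK v))) -sumrN; apply: eq_bigr => A _.
by rewrite fv -mulrN ffunE eqxx; congr (_ * _); case: (A v); rewrite /sg /= ?opprK.
Qed.

(** Induction on [r]: terms odd in the new sign vanish by [sum_sg_flip], so the mean fourth moment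
    grows by 6 c^2 q + c^4, within 3 (q + c^2)^2. The second moment is carried along for the middle
    term. *)
Lemma moments_rademacher (c : V -> R) (r : seq V) : uniq r ->
  let S (A : Om) := \sum_(v <- r) c v * sg (A v) in
  let q := \sum_(v <- r) c v ^+ 2 in
  \sum_A S A ^+ 2 = #|{: Om}|%:R * q /\
  \sum_A S A ^+ 4 <= 3 * #|{: Om}|%:R * q ^+ 2.
Proof.
elim: r => [|v r IH] /=.
  move=> _; split; under eq_bigr do rewrite big_nil expr0n.
    by rewrite big1 // big_nil mulr0.
  by rewrite big1 // big_nil expr0n mulr0.
case/andP => vr /IH; set S := fun A : Om => \sum_(_ <- r) _.
set q := \sum_(_ <- r) _ => -[S2 S4]; pose T (A : Om) := \sum_(u <- v :: r) c u * sg (A u).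
have Sv A : S (flip v A) = S A.
  apply: eq_big_seq => u ur; rewrite ffunE; case: eqP => // uv.
  by rewrite -uv ur in vr.
have TE A : T A = S A + c v * sg (A v) by rewrite /T big_cons addrC.
have sg2 b : sg b * sg b = 1 by case: b; rewrite /sg ?mulrNN mulr1.
have o1 : \sum_A S A * sg (A v) = 0 by apply: sum_sg_flip.
have o3 : \sum_A S A ^+ 3 * sg (A v) = 0.
  by apply: (@sum_sg_flip v (fun A => S A ^+ 3)) => A; rewrite Sv.
have cst (x : R) : \sum_(A : Om) x = #|{: Om}|%:R * x.
  by rewrite mulr_natl -sumr_const.
rewrite [\sum_(u <- _ :: _) _ ^+ 2]big_cons -/q.
suff : \sum_A T A ^+ 2 = #|{: Om}|%:R * (c v ^+ 2 + q) /\
  \sum_A T A ^+ 4 <= 3 * #|{: Om}|%:R * (c v ^+ 2 + q) ^+ 2 by [].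
split.
  transitivity (\sum_A S A ^+ 2 + 2 * c v * (\sum_A S A * sg (A v)) +
      \sum_(A : Om) c v ^+ 2).
    rewrite mulr_sumr -!big_split; apply: eq_bigr => A _; rewrite TE /=.
    have := sg2 (A v); move: (sg _) (S A) => s x s2.
    have -> : c v ^+ 2 = c v ^+ 2 * (s * s) by rewrite s2 mulr1.
    by ring.
  by rewrite o1 mulr0 addr0 S2 cst; ring.
have -> : \sum_A T A ^+ 4 = \sum_A S A ^+ 4 + 4 * c v * (\sum_A S A ^+ 3 * sg (A v)) +
    6 * c v ^+ 2 * (\sum_A S A ^+ 2) + 4 * c v ^+ 3 * (\sum_A S A * sg (A v)) +
    \sum_(A : Om) c v ^+ 4.
  rewrite !mulr_sumr -!big_split; apply: eq_bigr => A _; rewrite TE /=.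
  have := sg2 (A v); move: (sg _) (S A) => s x s2.
  transitivity (x ^+ 4 + 4 * c v * (x ^+ 3 * s) + 6 * c v ^+ 2 * x ^+ 2 * (s * s) +
      4 * c v ^+ 3 * (x * s) * (s * s) + c v ^+ 4 * (s * s) * (s * s)); first by ring.
  by rewrite s2; ring.
rewrite o1 o3 S2 cst; have := ler0n R #|{: Om}|; move: (#|{: Om}|%:R : R) S4 => K S4 K0.
have := mulr_ge0 K0 (sqr_ge0 (c v ^+ 2)).
move: (\sum_A S A ^+ 4) S4 => z S4 h; rewrite -subr_ge0.
have -> : 3 * K * (c v ^+ 2 + q) ^+ 2 - (z + 4 * c v * 0 + 6 * c v ^+ 2 * (K * q) +
  4 * c v ^+ 3 * 0 + K * c v ^+ 4) = (3 * K * q ^+ 2 - z) + 2 * (K * (c v ^+ 2) ^+ 2).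
  by ring.
by rewrite addr_ge0 ?subr_ge0 // mulr_ge0.
Qed.

End RademacherMoments.

(** Codes the integers in the order 0, 1, -1, 2, -2, ..., so that [uphalf] recovers the absolute
    value and bounded integers fit into an ordinal. *)
Definition zigzag (b : int) : nat :=
  match b with Posz k => k.*2.-1 | Negz k => k.+1.*2 end.

Lemma zigzag_inj : injective zigzag.
Proof. by move=> [x|x] [y|y] /=; lia. Qed.

Lemma uphalf_zigzag b : uphalf (zigzag b) = `|b|%N.
Proof. by case: b => x /=; lia. Qed.

Section PartialColoring.
Variable R : realType.

Lemma expRN1_le_half : expR (- 1) <= 1 / 2 :> R.
Proof.
rewrite expRN -div1r ler_pdivrMr ?expR_gt0 //.
by have := expR_ge1Dx (1 : R); lra.
Qed.

(** Each nonzero absolute value has two codes, so the sum is at most 1 + 2(x + x^2 + ...) with x =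
    exp(-t) <= 1/2. The induction keeps the explicit remainder. *)
Lemma sum_expR_uphalf (t : R) Z : 1 <= t ->
  \sum_(z < Z) expR (- (t * (uphalf z)%:R)) <= 1 + 4 * expR (- t).
Proof.
move=> t1; have et : expR (- t) <= 1 / 2.
  by apply: le_trans expRN1_le_half; rewrite ler_expR; lra.
have e0 := expR_gt0 (- t); set x := expR (- t) in et e0 *.
have xE z : expR (- (t * z%:R)) = x ^+ z by rewrite -mulNr -expRM_natr.
have H r : \sum_(z < r.*2.+1) expR (- (t * (uphalf z)%:R)) <=
    1 + 4 * x - 4 * x * (1 / 2) ^+ r.
  elim: r => [|r IH].
    by rewrite big_ord_recr big_ord0 /= mulr0 oppr0 expR0 expr0; lra.
  rewrite doubleS big_ord_recr big_ord_recr /=.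
  rewrite doubleK uphalf_double xE; have : x ^+ r.+1 <= x * (1 / 2) ^+ r.
    by rewrite exprS ler_pM2l // lerXn2r ?nnegrE //; lra.
  by rewrite [in X in _ -> _ <= X]exprS; lra.
have {H} := H Z; have : 0 <= 4 * x * (1 / 2) ^+ Z :> R.
  by rewrite !mulr_ge0 ?exprn_ge0 ?ltW //; lra.
suff : \sum_(z < Z) expR (- (t * (uphalf z)%:R)) <=
    \sum_(z < Z.*2.+1) expR (- (t * (uphalf z)%:R)) by lra.
have ZZ : (Z <= Z.*2.+1)%N by lia.
rewrite (big_ord_widen _ (fun z => expR (- (t * (uphalf z)%:R))) ZZ) big_mkcond.
by apply: ler_sum => z _; case: ifP => // _; rewrite expR_ge0.
Qed.

Variable V : finType.
Notation Om := ({ffun V -> bool}).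

Lemma card_Om : #|{: Om}|%:R = \prod_(v : V) 2 :> R.
Proof. by rewrite card_ffun card_bool prodr_const natrX. Qed.

(** Chernoff bound: the indicator of distance d <= m/8 is at most exp(m/8 - d), and the sum of
    exp(-d) factors over the points. A point of X gives 1 + 1/e <= 3/2 <= 2 exp(-1/4). *)
Lemma hamming_ball (X : {set V}) (A0 : Om) :
  #|[pred A : Om | 8 * #|[set v in X | A v != A0 v]| <= #|X|]%N|%:R <=
  #|{: Om}|%:R * expR (- (#|X|%:R / 8)) :> R.
Proof.
set m := #|X|; pose d (A : Om) := #|[set v in X | A v != A0 v]|.
pose g v b : R := if (v \in X) && (b != A0 v) then expR (- 1) else 1.
have dE (A : Om) : expR (- (d A)%:R) = \prod_v g v (A v).
  rewrite /g -big_mkcond /= prodr_const -mulrN1 expRM_natl; congr (_ ^+ _).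
  by apply: eq_card => v; rewrite !inE.
apply: (@le_trans _ _ (\sum_(A : Om) expR (m%:R / 8) * expR (- (d A)%:R))).
  rewrite -sum1_card natr_sum big_mkcond /=; apply: ler_sum => A _.
  case: ifP => [h|_]; last by rewrite mulr_ge0 ?expR_ge0.
  rewrite -expRD; apply: le_trans (expR_ge1Dx _); rewrite lerDl subr_ge0.
  by rewrite ler_pdivlMr // -natrM ler_nat mulnC.
rewrite -mulr_sumr; under eq_bigr do rewrite dE.
rewrite -(bigA_distr_bigA g) /= card_Om.
have -> : expR (- (m%:R / 8)) = expR (m%:R / 8) * expR (- (m%:R / 4)) :> R.
  by rewrite -expRD; congr expR; lra.
rewrite mulrCA ler_pM2l ?expR_gt0 //.
have -> : expR (- (m%:R / 4)) = \prod_v (if v \in X then expR (- (1 / 4)) else 1) :> R.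
  by rewrite -big_mkcond /= prodr_const -expRM_natl; congr expR; rewrite -/m; ring.
rewrite -big_split /=; apply: ler_prod => v _; rewrite /g big_bool.
rewrite addr_ge0 ?(fun_if (fun x => 0 <= x)) ?expR_ge0 ?ler01 ?if_same //=.
case: (v \in X) => /=; last by lra.
have := expR_ge1Dx (- (1 / 4) : R); have := expRN1_le_half.
by case: (A0 v) => /=; lra.
Qed.

Variables (I : finType) (X : {set V}) (a : I -> V -> R) (D t q : I -> R).
Hypotheses (D0 : forall i, 0 < D i) (t1 : forall i, 1 <= t i).
Hypothesis hq : forall i, \sum_(v in X) a i v ^+ 2 <= q i.

Let S i (A : Om) := \sum_(v in X) a i v * sg R (A v).
(** The nearest integer to S/(2D). Half the difference of two colourings with equal roundings then
    has sum at most D. *)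
Let b i (A : Om) : int := Num.floor (S i A / (2 * D i) + 1 / 2).

Let b_itv i A : (b i A)%:~R <= S i A / (2 * D i) + 1 / 2 < (b i A)%:~R + 1.
Proof. by have := floor_itv (S i A / (2 * D i) + 1 / 2); rewrite -/(b i A) intrD. Qed.

Let same_b i A B : b i A = b i B -> `|S i A - S i B| <= 2 * D i.
Proof.
move=> E; have := b_itv i A; have := b_itv i B; rewrite E.
have d2 : 0 < 2 * D i by have := D0 i; lra.
move=> /andP[l1 u1] /andP[l2 u2].
have : `|S i A / (2 * D i) - S i B / (2 * D i)| <= 1 by rewrite ler_norml; lra.
by rewrite -mulrBl normrM normfV [`|2 * _|]gtr0_norm // ler_pdivrMr // mul1r.
Qed.

(** A nonzero rounding satisfies 1 <= |b| <= |S|/D, and a number that is at least 1 is at most its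
    fourth power. *)
Let b_moment i A : `|b i A|%N%:R <= (S i A) ^+ 4 / D i ^+ 4.
Proof.
have d0 := D0 i; have := b_itv i A; set x := S i A / (2 * D i); move=> /andP[l u].
have xE : S i A / D i = 2 * x by rewrite /x; field; lra.
have -> : S i A ^+ 4 / D i ^+ 4 = (2 * x) ^+ 4 by rewrite -xE expr_div_n.
rewrite natr_absz intr_norm; set y : R := (b i A)%:~R in l u *.
have [y0|y1] : y = 0 \/ 1 <= `|y|.
  rewrite /y -intr_norm; have [->|nz] := eqVneq (b i A) 0; first by left.
  by right; rewrite -[1]/(1%:~R) ler_int -gtz0_ge1 normr_gt0.
  by rewrite y0 normr0; apply: exprn_even_ge0.
have yx : `|y| <= 2 * `|x|.
  by move: y1; case: (ger0P y); case: (ger0P x); lra.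
have h1 : 1 <= 2 * `|x| by apply: le_trans yx.
apply: le_trans yx _; rewrite -[leRHS]ger0_norm ?exprn_even_ge0 // normrX.
by rewrite (normrM 2 x) normr_nat ler_eXnr.
Qed.

(** The weight exp(-cost) depends on the roundings only and factors over i. It replaces entropy: its
    total is bounded below by the mean cost and above by the size of the largest class of equal
    roundings. *)
Let cost A := \sum_i t i * `|b i A|%N%:R.
Let C := \sum_i 3 * t i * q i ^+ 2 / D i ^+ 4.

Let sum_cost : \sum_A cost A <= #|{: Om}|%:R * C.
Proof.
rewrite exchange_big /= mulr_sumr; apply: ler_sum => i _.
have d4 : 0 < D i ^+ 4 by rewrite exprn_gt0.
apply: (@le_trans _ _ (t i / D i ^+ 4 * \sum_A S i A ^+ 4)).
  rewrite mulr_sumr; apply: ler_sum => A _.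
  rewrite -mulrA ler_pM2l; last by have := t1 i; lra.
  by rewrite mulrC; exact: b_moment.
have [_] := moments_rademacher (a i) (enum_uniq X).
rewrite big_enum /=; under eq_bigr do rewrite big_enum /=.
rewrite -/(S i _) => M4.
apply: (@le_trans _ _ (t i / D i ^+ 4 * (3 * #|{: Om}|%:R * q i ^+ 2))).
  rewrite ler_wpM2l //; first by rewrite divr_ge0 ?ltW //; have := t1 i; lra.
  apply: le_trans M4 _; rewrite ler_wpM2l ?mulr_ge0 //.
  have s0 : 0 <= \sum_(v in X) a i v ^+ 2 by apply: sumr_ge0 => v _; exact: sqr_ge0.
  by rewrite lerXn2r ?nnegrE ?(le_trans s0).
by rewrite le_eqVlt; apply/orP; left; apply/eqP; field; rewrite gt_eqF.
Qed.

(* Jensen's inequality, through the tangent line [1 + x <= exp x]. *)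
Let sum_exp_cost : #|{: Om}|%:R * expR (- C) <= \sum_A expR (- cost A).
Proof.
apply: (@le_trans _ _ (\sum_A expR (- C) * (1 + (C - cost A)))).
  rewrite -mulr_sumr [leLHS]mulrC ler_pM2l ?expR_gt0 //.
  rewrite !big_split sumrN /= sumr_const sumr_const -mulr_natl mulr1 -[C *+ _]mulr_natl.
  by have := sum_cost; lra.
apply: ler_sum => A _.
rewrite -[X in _ <= expR X](addKr C).
by rewrite expRD ler_pM2l ?expR_gt0 // expR_ge1Dx.
Qed.

Let Z := \max_i \max_A zigzag (b i A).
Let key (A : Om) : {ffun I -> 'I_Z.+1} := [ffun i => inord (zigzag (b i A))].

Let keyE A i : key A i = zigzag (b i A) :> nat.
Proof.
rewrite ffunE inordK // ltnS.
apply: leq_trans (leq_bigmax i); exact: (leq_bigmax (F := fun A => zigzag (b i A))).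
Qed.

Let same_key A B i : key A = key B -> b i A = b i B.
Proof. by move=> E; apply: zigzag_inj; rewrite -!keyE E. Qed.

(** Group the colourings by key; the sum of the weights over all conceivable keys is a product over
    i of geometric sums. *)
Let sum_cost_le (M : R) : 0 <= M ->
  (forall f, #|[pred A | key A == f]|%:R <= M) ->
  \sum_A expR (- cost A) <= M * expR (\sum_i 4 * expR (- t i)).
Proof.
move=> M0 hM; pose W i (z : 'I_Z.+1) := expR (- (t i * (uphalf z)%:R)).
have cW A : expR (- cost A) = \prod_i W i (key A i).
  rewrite -sumrN expR_sum; apply: eq_bigr => i _.
  by rewrite /W keyE uphalf_zigzag.
under eq_bigr do rewrite cW.
rewrite (partition_big key predT) //=.
apply: (@le_trans _ _ (\sum_(f : {ffun I -> 'I_Z.+1}) M * \prod_i W i (f i))).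
  apply: ler_sum => f _.
  have -> : \sum_(A | key A == f) \prod_i W i (key A i) =
      \sum_(A | key A == f) \prod_i W i (f i) by apply: eq_bigr => A /eqP ->.
  rewrite sumr_const -[_ *+ _]mulr_natl ler_wpM2r //; last exact: hM.
  by apply: prodr_ge0 => i _; exact: expR_ge0.
rewrite -mulr_sumr ler_wpM2l // -(bigA_distr_bigA W) expR_sum /=.
apply: ler_prod => i _; rewrite sumr_ge0 /=; last by move=> z _; exact: expR_ge0.
by apply: le_trans (sum_expR_uphalf _ (t1 i)) (expR_ge1Dx _).
Qed.

(** If colourings with equal keys always differed on at most |X|/8 points, every key class would lie
    in a Hamming ball, and the two bounds on the total weight would contradict the hypothesis.
    Otherwise take half the difference of two far colourings with one key. *)
Lemma partial_coloring :
  \sum_i (3 * t i * q i ^+ 2 / D i ^+ 4 + 4 * expR (- t i)) < #|X|%:R / 8 ->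
  exists x : V -> R,
    [/\ forall v, v \notin X -> x v = 0,
        forall v, x v = 0 \/ `|x v| = 1,
        (#|X| < 8 * #|[set v | x v != 0%R]|)%N &
        forall i, `|\sum_(v in X) a i v * x v| <= D i].
Proof.
rewrite big_split /= -/C => hC.
have [A0 [A1 [kE dE]]] : exists A0 A1, key A0 = key A1 /\
    (#|X| < 8 * #|[set v in X | A1 v != A0 v]|)%N.
  have [/existsP[A0 /existsP[A1 /andP[/eqP kE dE]]]|H] :=
    boolP [exists A0, [exists A1, (key A0 == key A1) &&
      (#|X| < 8 * #|[set v in X | A1 v != A0 v]|)%N]].
    by exists A0, A1.
  have Om0 : 0 < #|{: Om}|%:R :> R by rewrite card_Om prodr_gt0.
  pose M : R := #|{: Om}|%:R * expR (- (#|X|%:R / 8)).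
  have M0 : 0 <= M by rewrite mulr_ge0 ?expR_ge0.
  have hM f : #|[pred A | key A == f]|%:R <= M.
    have [A0 /eqP kA0|none] := pickP [pred A | key A == f]; last first.
      by rewrite eq_card0.
    apply: le_trans (hamming_ball X A0); rewrite ler_nat.
    apply/subset_leq_card/subsetP => A; rewrite !inE => /eqP kA.
    rewrite leqNgt; apply: contra H => h.
    by apply/existsP; exists A0; apply/existsP; exists A; rewrite kA0 kA eqxx.
  have := le_trans sum_exp_cost (sum_cost_le M0 hM).
  rewrite /M -mulrA ler_pM2l // -expRD ler_expR; lra.
have e1 : (1 - -1) / 2 = 1 :> R by lra.
have e2 : (-1 - 1) / 2 = -1 :> R by lra.
exists (fun v => if v \in X then (sg R (A0 v) - sg R (A1 v)) / 2 else 0); split.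
- by move=> v /negbTE ->.
- move=> v; case: ifP => _; last by left.
  rewrite /sg; case: (A0 v); case: (A1 v); rewrite ?subrr ?mul0r; try by left.
    by right; rewrite e1 normr1.
  by right; rewrite e2 normrN1.
- apply: leq_trans dE _; rewrite leq_mul2l /=; apply/subset_leq_card/subsetP => v.
  rewrite !inE => /andP[-> ne]; rewrite /sg; case: (A0 v) ne; case: (A1 v) => // _.
    by rewrite e1 oner_eq0.
  by rewrite e2 oppr_eq0 oner_eq0.
- move=> i; have := same_b (same_key i kE).
  have -> : \sum_(v in X) a i v * (if v \in X then (sg R (A0 v) - sg R (A1 v)) / 2 else 0) =
      (S i A0 - S i A1) / 2.
    rewrite -sumrB mulr_suml; apply: eq_bigr => v ->.
    by rewrite -mulrBr mulrA.
  by rewrite normrM normfV normr_nat ler_pdivrMr //; lra.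
Qed.

End PartialColoring.

(** * Colouring many linear orders *)

Section MultiScale.
Variable R : realType.

Lemma geometric_tail (r : R) (m w : nat) : 0 <= r -> (w <= m)%N ->
  (1 - r) * (\sum_(i < w) r ^+ (m - i)) <= r ^+ (m - w).+1.
Proof.
move=> r0; elim: w => [|w IH] wm; first by rewrite big_ord0 mulr0 exprn_ge0.
rewrite big_ord_recr /= mulrDr; apply: le_trans (lerD (IH (ltnW wm)) (lexx _)) _.
by rewrite subnSK // exprS; lra.
Qed.

(** The binary digits of z split the prefix into at most one aligned block per level; the induction
    peels off the top digit. *)
Lemma dyadic_prefix (T : Type) (f : T -> R) (w : nat) (d : nat -> R) (L : seq T) :
  (forall i, 0 <= d i) ->
  (forall i b, (i < w)%N -> (b < 2 ^ (w - i))%N ->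
     `|\sum_(e <- take (2 ^ i) (drop (b * 2 ^ i) L)) f e| <= d i) ->
  forall z, (z < 2 ^ w)%N -> `|\sum_(e <- take z L) f e| <= \sum_(i < w) d i.
Proof.
move=> d0; elim: w L => [|w IH] L H z.
  by case: z => // _; rewrite take0 big_nil big_ord0 normr0.
rewrite big_ord_recr /= expnS => zw; have [lt|le] := ltnP z (2 ^ w).
  apply: (@le_trans _ _ (\sum_(i < w) d i)); last by rewrite lerDl.
  apply: IH => // i b iw bw; apply: H; first exact: ltnW.
  by apply: leq_trans bw _; rewrite leq_exp2l // leq_sub2r.
have -> : take z L = take (2 ^ w) L ++ take (z - 2 ^ w) (drop (2 ^ w) L).
  by rewrite -takeD subnKC.
rewrite big_cat /= addrC; apply: le_trans (ler_normD _ _) _; apply: lerD.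
  apply: IH; last by rewrite ltn_subLR //; lia.
  move=> i b iw bw; rewrite drop_drop.
  have -> : (b * 2 ^ i + 2 ^ w = (b + 2 ^ (w - i)) * 2 ^ i)%N.
    by rewrite mulnDl -expnD subnK // ltnW.
  apply: H; first exact: ltnW.
  by rewrite subSn ?(ltnW iw) // expnS mul2n -addnn ltn_add2r.
by have := H w 0%N (ltnSn _); rewrite mul0n drop0 subSnn; apply.
Qed.

Variables (V J : finType) (T : eqType) (var : T -> V) (sgn : T -> R).
Variables (o : J -> seq T) (nu : nat).
Hypotheses (sgn1 : forall e, `|sgn e| <= 1).
Hypothesis cov : forall j v, (count (fun e => var e == v) (o j) <= 2)%N.
Hypothesis cardJ : (#|J| <= 2 ^ nu)%N.

Let rest (X : {set V}) j := [seq e <- o j | var e \in X].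

Lemma size_rest X j : (size (rest X j) <= 2 * #|X|)%N.
Proof.
rewrite size_filter -sum1_count.
have -> : (\sum_(e <- o j | var e \in X) 1 =
    \sum_(v in X) \sum_(e <- o j | var e == v) 1)%N.
  rewrite (partition_big var (mem X)) //=; apply: eq_bigr => v vX.
  by apply: eq_bigl => e; apply: andb_idl => /eqP ->.
rewrite mulnC -sum_nat_const; apply: leq_sum => v _.
by rewrite sum1_count.
Qed.

(** A block sum as a linear form in the variables. By [cov] a coefficient is at most 2 in absolute
    value. *)
Let coef (B : seq T) v : R := \sum_(e <- B | var e == v) sgn e.

Lemma sum_coef (X : {set V}) (B : seq T) (x : V -> R) : all (fun e => var e \in X) B ->
  \sum_(v in X) coef B v * x v = \sum_(e <- B) sgn e * x (var e).
Proof.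
move=> /allP BX; rewrite [RHS]big_seq (partition_big var (mem X)) //=.
apply: eq_bigr => v _; rewrite mulr_suml [LHS]big_seq_cond.
by apply: eq_bigr => e /andP[_ /eqP ->].
Qed.

Lemma sum_coef_sqr (X : {set V}) j (B : seq T) : subseq B (o j) ->
  \sum_(v in X) coef B v ^+ 2 <= 2 * (size B)%:R.
Proof.
move=> Bo; pose c v := count (fun e => var e == v) B.
apply: (@le_trans _ _ (\sum_v 2 * (c v)%:R)).
  rewrite big_mkcond /=; apply: ler_sum => v _; case: ifP => _; last by rewrite mulr_ge0.
  have hc : `|coef B v| <= (c v)%:R.
    apply: le_trans (ler_norm_sum _ _ _) _; rewrite /c -sum1_count natr_sum.
    by apply: ler_sum => e _.
  have c2 : (c v)%:R <= 2 :> R.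
    by rewrite ler_nat; apply: leq_trans (cov j v); apply: leq_count_subseq.
  rewrite -[leLHS]real_normK ?num_real //; have := normr_ge0 (coef B v); nra.
rewrite -mulr_sumr -natr_sum /c ler_pM2l // ler_nat -sum1_size.
rewrite (partition_big var predT) //=.
by apply: leq_sum => v _; rewrite sum1_count.
Qed.

Let s : R := Num.sqrt 2.
(** Level i means blocks of length 2^i. The bounds [Dl] lose a factor [rho] per level below nu + 1,
    so they sum over levels and over rounds, while 2 rho^4 > 5/4 still lets the cost decay; [tl]
    grows fast enough for exp(-tl) to beat the number of blocks. *)
Let rho : R := 9 / 10.
Let Dl (i : nat) : R := 30 * s ^+ nu * rho ^+ (nu.+1 - i).
Let tl (i : nat) : R := 8 + 2 * (nu.+1 - i)%:R.
Let ql (i : nat) : R := 2 * 2 ^+ i.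

Let s0 : 0 < s. Proof. by rewrite sqrtr_gt0. Qed.

(** Put h = nu + 1 - i; the factor 2^h accounts for the number of blocks. The first part is a
    constant times (8 + 2h) (2 rho^4)^(-h), where 8 + 2h <= 8 (5/4)^h and (5/4)/(2 rho^4) <= 24/25.
    The second uses 1/e <= 1/2. *)
Lemma level_cost i : (i <= nu)%N ->
  2 ^+ (nu.+1 - i) * (3 * tl i * ql i ^+ 2 / Dl i ^+ 4 + 4 * expR (- tl i)) <=
  1 / 2000 * (24 / 25) ^+ (nu.+1 - i) + 1 / 64 * (1 / 2) ^+ (nu.+1 - i).
Proof.
move=> inu; rewrite /Dl /tl /ql; set h := (nu.+1 - i)%N.
have s4 : s ^+ 4 = 4 by rewrite (exprM _ 2 2) sqr_sqrtr // -natrX.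
have nuE : nu.+1 = (i + h)%N by rewrite subnKC // ltnW.
have D4 : (30 * s ^+ nu * rho ^+ h) ^+ 4 = 30 ^+ 4 * 4 ^+ nu * (rho ^+ 4) ^+ h.
  by rewrite 2!exprMn [s ^+ nu ^+ 4]exprAC s4 [rho ^+ h ^+ 4]exprAC.
have q2 : 4 * (2 * 2 ^+ i) ^+ 2 * 4 ^+ h = 16 * (4 * 4 ^+ nu) :> R.
  rewrite -[4 * 4 ^+ nu]exprS nuE exprMn [2 ^+ i ^+ 2]exprAC.
  have -> : 2 ^+ 2 = 4 :> R by rewrite -natrX.
  by rewrite exprD; ring.
rewrite D4.
have bern : 8 + 2 * h%:R <= 8 * (5 / 4) ^+ h :> R.
  elim: (h) => [|k IH]; first by rewrite expr0; lra.
  by rewrite exprS -natr1; have := ler0n R k; lra.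
have e2 : expR (- (8 + 2 * h%:R)) <= (1 / 2) ^+ 8 * (1 / 2) ^+ h * (1 / 2) ^+ h :> R.
  have -> : - (8 + 2 * h%:R) = (8 + h + h)%:R * (- 1) :> R by rewrite !natrD; ring.
  by rewrite expRM_natl -!exprD lerXn2r ?nnegrE ?expR_ge0 ?expRN1_le_half //; lra.
have p2 : 2 ^+ h * (1 / 2) ^+ h = 1 :> R.
  by rewrite -exprMn (_ : 2 * (1 / 2) = 1) ?expr1n //; lra.
have n0 : 4 ^+ nu != 0 :> R by rewrite -natrX pnatr_eq0 expn_eq0.
have h0 : 4 ^+ h != 0 :> R by rewrite -natrX pnatr_eq0 expn_eq0.
have r0 : (rho ^+ 4) ^+ h != 0 by rewrite expf_neq0 // expf_neq0 // /rho; lra.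
rewrite mulrDr; apply: lerD.
  have -> : 2 ^+ h * (3 * (8 + 2 * h%:R) * (2 * 2 ^+ i) ^+ 2 /
      (30 ^+ 4 * 4 ^+ nu * (rho ^+ 4) ^+ h)) =
      48 / 30 ^+ 4 * (8 + 2 * h%:R) * (1 / (2 * rho ^+ 4)) ^+ h.
    have -> : 2 ^+ h = 4 ^+ h / 2 ^+ h :> R.
      by rewrite -expr_div_n; congr (_ ^+ _); lra.
    have -> : (1 / (2 * rho ^+ 4)) ^+ h = 1 / (2 ^+ h * (rho ^+ 4) ^+ h).
      by rewrite (expr_div_n 1 (2 * _)) expr1n (exprMn h 2).
    have -> : 3 * (8 + 2 * h%:R) * (2 * 2 ^+ i) ^+ 2 = 3 * (8 + 2 * h%:R) / 4 ^+ h *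
        (4 * (2 * 2 ^+ i) ^+ 2 * 4 ^+ h) / 4 :> R by field.
    rewrite q2; field; rewrite r0 n0 h0 !expf_neq0 //.
    by rewrite /rho; lra.
  have r4 : 25 / 24 * (5 / 8) <= rho ^+ 4 by rewrite /rho (exprM _ 2 2) !expr2; lra.
  have r4p : 0 < 2 * rho ^+ 4 by lra.
  have c30 : 0 < 48 / 30 ^+ 4 :> R by rewrite divr_gt0 ?exprn_gt0.
  have i0 : 0 < (1 / (2 * rho ^+ 4)) ^+ h by rewrite exprn_gt0 // divr_gt0.
  apply: (@le_trans _ _ (48 / 30 ^+ 4 * (8 * (5 / 4) ^+ h) * (1 / (2 * rho ^+ 4)) ^+ h)).
    by rewrite ler_pM2r // ler_pM2l.
  have -> : 48 / 30 ^+ 4 * (8 * (5 / 4) ^+ h) * (1 / (2 * rho ^+ 4)) ^+ h =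
      8 * 48 / 30 ^+ 4 * (5 / 4 * (1 / (2 * rho ^+ 4))) ^+ h.
    by rewrite (exprMn h (5 / 4)); field; rewrite /rho; lra.
  have b0 : 0 <= 5 / 4 * (1 / (2 * rho ^+ 4)).
    by rewrite mulr_ge0 ?divr_ge0 ?(ltW r4p).
  apply: ler_pM; first by rewrite divr_ge0 ?exprn_ge0 ?mulr_ge0.
  - exact: exprn_ge0.
  - rewrite ler_pdivrMr ?exprn_gt0 // (exprM _ 2 2) !expr2; lra.
  apply: lerXn2r => //; rewrite ?nnegrE ?divr_ge0 //.
  by rewrite mulrA mulr1 ler_pdivrMr //; lra.
have P0 : 0 < (1 / 2) ^+ h :> R by rewrite exprn_gt0 //; lra.
have P2 : 0 < 2 ^+ h :> R by rewrite exprn_gt0 //.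
apply: (@le_trans _ _ (2 ^+ h * (4 * ((1 / 2) ^+ 8 * (1 / 2) ^+ h * (1 / 2) ^+ h)))).
  by rewrite ler_pM2l // ler_pM2l.
have -> : 2 ^+ h * (4 * ((1 / 2) ^+ 8 * (1 / 2) ^+ h * (1 / 2) ^+ h)) =
   4 * (1 / 2) ^+ 8 * (2 ^+ h * (1 / 2) ^+ h) * (1 / 2) ^+ h :> R by ring.
by rewrite p2 mulr1; have : (1 / 2) ^+ 8 = 1 / 256 :> R by [field|]; lra.
Qed.

(** Restricted to X, every order has fewer than 2^(mu+2) entries. [partial_coloring] is applied to
    all their dyadic blocks of level below mu + 2. *)
Lemma partial_step (mu : nat) (X : {set V}) : (mu.+1 <= nu)%N ->
  (2 ^ mu <= #|X| < 2 ^ mu.+1)%N ->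
  exists x : V -> R,
    [/\ forall v, v \notin X -> x v = 0,
        forall v, x v = 0 \/ `|x v| = 1,
        (#|X| < 8 * #|[set v | x v != 0%R]|)%N &
        forall j z, `|\sum_(e <- take z (o j)) sgn e * x (var e)| <=
          300 * s ^+ nu * rho ^+ (nu - mu)].
Proof.
move=> munu /andP[Xlo Xhi]; pose w := mu.+2.
pose I := (J * {i : 'I_w & 'I_(2 ^ (w - i))})%type.
pose lev (c : I) : nat := tag c.2.
pose B (c : I) := take (2 ^ lev c) (drop (tagged c.2 * 2 ^ lev c) (rest X c.1)).
have rho0 : 0 < rho by rewrite /rho; lra.
have D0 i : 0 < Dl i by rewrite !mulr_gt0 ?exprn_gt0.
have Bsub c : subseq (B c) (rest X c.1).
  exact: subseq_trans (take_subseq _ _) (drop_subseq _ _).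
have BX c : all (fun e => var e \in X) (B c).
  apply/allP => e /(mem_subseq (Bsub c)).
  by rewrite mem_filter => /andP[].
have [||||x [x0 x1 xX xB]] := @partial_coloring R V I X (fun c => coef (B c))
    (fun c => Dl (lev c)) (fun c => tl (lev c)) (fun c => ql (lev c)).
- by move=> c; exact: D0.
- by move=> c; rewrite /tl; have := ler0n R (nu.+1 - lev c); lra.
- move=> c; apply: (le_trans (@sum_coef_sqr X c.1 (B c) _)).
    exact: subseq_trans (Bsub c) (filter_subseq _ _).
  by rewrite ler_pM2l // -natrX ler_nat size_take_min geq_minl.
- pose g i : R := 3 * tl i * ql i ^+ 2 / Dl i ^+ 4 + 4 * expR (- tl i).
  have -> : \sum_(c : I) (3 * tl (lev c) * ql (lev c) ^+ 2 / Dl (lev c) ^+ 4 +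
       4 * expR (- tl (lev c))) = #|J|%:R * \sum_(i < w) 2 ^+ (w - i) * g i.
    rewrite -(pair_big predT predT
      (fun (_ : J) (c : {i : 'I_w & 'I_(2 ^ (w - i))}) => g (tag c))) /=.
    rewrite sum_const_pred; congr (_ * _).
    rewrite -(sig_big_dep predT (fun _ => predT)
      (fun (i : 'I_w) (_ : 'I_(2 ^ (w - i))) => g i)) /=.
    by apply: eq_bigr => i _; rewrite sum_const_pred card_ord natrX.
  have g0 i : 0 <= g i.
    rewrite addr_ge0 ?mulr_ge0 ?expR_ge0 ?invr_ge0 ?exprn_ge0 ?(ltW (D0 i)) //.
    by rewrite addr_ge0 ?mulr_ge0.
  have tail (r : R) : 0 <= r -> r <= 1 -> (1 - r) * \sum_(i < w) r ^+ (nu.+1 - i) <= 1.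
    move=> r0 r1; apply: le_trans (geometric_tail r0 (munu : (w <= nu.+1)%N)) _.
    exact: exprn_ile1.
  (* The two geometric sums are at most 25 and 2, so the cost is at most 2^mu (1/40 + 1/16) < 2^mu/8
     <= |X|/8. *)
  have T1 := tail (24 / 25) ltac:(lra) ltac:(lra).
  have T2 := tail (1 / 2) ltac:(lra) ltac:(lra).
  apply: (@le_lt_trans _ _ (2 ^+ mu.+1 * \sum_(i < w) 2 ^+ (nu.+1 - i) * g i)).
    rewrite !mulr_sumr; apply: ler_sum => i _; rewrite !mulrA -exprD ler_wpM2r //.
    have inu : (i <= nu)%N by have := ltn_ord i; rewrite /w; lia.
    have -> : (mu.+1 + (nu.+1 - i) = nu + (w - i))%N.
      by have := ltn_ord i; rewrite /w; lia.
    by rewrite exprD ler_wpM2r ?exprn_ge0 // -natrX ler_nat.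
  apply: (@le_lt_trans _ _ (2 ^+ mu.+1 * (1 / 2000 * (\sum_(i < w) (24 / 25) ^+ (nu.+1 - i)) +
      1 / 64 * (\sum_(i < w) (1 / 2) ^+ (nu.+1 - i))))).
    rewrite ler_pM2l ?exprn_gt0 // !mulr_sumr -big_split /=; apply: ler_sum => i _.
    by apply: level_cost; have := ltn_ord i; rewrite /w; lia.
  have Xlo' : 2 ^+ mu <= #|X|%:R :> R by rewrite -natrX ler_nat.
  have p0 : 0 < 2 ^+ mu :> R by rewrite exprn_gt0.
  rewrite exprS; move: (\sum_(i < w) _) (\sum_(i < w) _) T1 T2 => y1 y2 T1 T2; nra.
exists x; split=> // j z.
(* As x vanishes off X, a prefix of the order may be replaced by the prefix of its restriction. *)
have -> : \sum_(e <- take z (o j)) sgn e * x (var e) =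
   \sum_(e <- take (count (fun e => var e \in X) (take z (o j))) (rest X j)) sgn e * x (var e).
  rewrite (bigID (fun e => var e \in X)) /= [X in _ + X]big1 ?addr0; last first.
    by move=> e /x0 ->; rewrite mulr0.
  rewrite -big_filter; congr (\sum_(e <- _) _).
  have -> : rest X j = [seq e <- take z (o j) | var e \in X] ++
      [seq e <- drop z (o j) | var e \in X] by rewrite -filter_cat cat_take_drop.
  by rewrite take_cat size_filter ltnn subnn take0 cats0.
apply: (@le_trans _ _ (\sum_(i < w) Dl i)).
  apply: dyadic_prefix; first by move=> i; exact: ltW.
    move=> i b iw bw.
    pose c : I := (j, Tagged (fun i : 'I_w => 'I_(2 ^ (w - i)))
      (Ordinal bw : 'I_(2 ^ (w - Ordinal iw)))).
    by have := xB c; rewrite sum_coef.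
  apply: (@leq_ltn_trans (2 * #|X|)); last by rewrite expnS ltn_pmul2l.
  apply: leq_trans (size_rest X j); rewrite /rest size_filter.
  by rewrite -{2}(cat_take_drop z (o j)) count_cat leq_addr.
rewrite -mulr_sumr.
have := geometric_tail (ltW rho0) (munu : (w <= nu.+1)%N).
rewrite {2}/w subSS subnSK // => G.
have -> : 300 * s ^+ nu * rho ^+ (nu - mu) = 30 * s ^+ nu * (10 * rho ^+ (nu - mu)) by ring.
rewrite ler_pM2l ?mulr_gt0 ?exprn_gt0 //.
by move: G; rewrite [in X in X -> _]/rho; lra.
Qed.

(** While at least 2^mu points remain, a partial step colours more than 2^mu/8 of them, so at most
    eight steps lead from below 2^(mu+1) to below 2^mu. The inner induction counts these steps by
    [c]. *)
Lemma full_coloring (mu : nat) (X : {set V}) : (mu <= nu)%N -> (#|X| < 2 ^ mu)%N ->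
  exists x : V -> R,
    [/\ forall v, v \notin X -> x v = 0, forall v, v \in X -> `|x v| = 1 &
        forall j z, `|\sum_(e <- take z (o j)) sgn e * x (var e)| <=
          30 * 720 * s ^+ nu * rho ^+ (nu - mu)].
Proof.
have rho0 : 0 < rho by rewrite /rho; lra.
elim: mu X => [|mu IH] X munu.
  rewrite expn0 ltnS leqn0 cards_eq0 => /eqP ->.
  exists (fun=> 0); split => // [v|j z]; first by rewrite inE.
  rewrite big1 ?normr0; last by move=> e _; rewrite mulr0.
  by rewrite !mulr_ge0 ?exprn_ge0 // ltW.
pose bd (c : nat) := 30 * 720 * s ^+ nu * rho ^+ (nu - mu) +
  c%:R * (300 * s ^+ nu * rho ^+ (nu - mu)).
suff H c (Y : {set V}) : (c <= 8)%N -> (8 * #|Y| < 2 ^ mu * (8 + c))%N ->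
  exists x : V -> R,
    [/\ forall v, v \notin Y -> x v = 0, forall v, v \in Y -> `|x v| = 1 &
        forall j z, `|\sum_(e <- take z (o j)) sgn e * x (var e)| <= bd c].
  move=> X2; have [//||x [x0 x1 xb]] := H 8%N X.
    by move: X2; rewrite expnS; lia.
  exists x; split=> // j z; apply: le_trans (xb j z) _.
  rewrite /bd -(subnSK munu) exprS.
  have : 0 < s ^+ nu * rho ^+ (nu - mu.+1) by rewrite mulr_gt0 ?exprn_gt0.
  (* The constant 30 * 720 = 21600 is the fixed point: (21600 + 8 * 300) * 9/10 = 21600. *)
  set y := rho ^+ _; set u := s ^+ _ => uy.
  have -> : 30 * 720 * u * (rho * y) + 8 * (300 * u * (rho * y)) =
    (30 * 720 + 2400) * rho * (u * y) by ring.
  have -> : 30 * 720 * u * y = 30 * 720 * (u * y) by ring.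
  by rewrite ler_pM2r // /rho; lra.
elim: c Y => [|c IHc] Y c8 hY.
  have [||x [x0 x1 xb]] := IH Y; [exact: ltnW|by move: hY; lia|].
  by exists x; split=> // j z; apply: le_trans (xb j z) _; rewrite /bd mul0r addr0.
have B0 : 0 <= 300 * s ^+ nu * rho ^+ (nu - mu).
  by rewrite !mulr_ge0 ?exprn_ge0 // ltW.
have [small|big] := ltnP #|Y| (2 ^ mu).
  have [||x [x0 x1 xb]] := IH Y => //; first exact: ltnW.
  exists x; split=> // j z; apply: le_trans (xb j z) _.
  by rewrite lerDl mulr_ge0.
have [|x [x0 x1 xs xb]] := @partial_step mu Y munu.
  by rewrite big /=; move: hY; rewrite expnS; nia.
pose Y' := Y :\: [set v | x v != 0].
have [||y [y0 y1 yb]] := IHc Y'; first exact: ltnW.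
  have sub : [set v | x v != 0] \subset Y.
    by apply/subsetP => v; rewrite inE; apply: contraNT => /x0 ->.
  by rewrite cardsD (setIidPr sub); have := subset_leq_card sub; nia.
exists (fun v => x v + y v); split.
- by move=> v vY; rewrite x0 // y0 ?addr0 // inE (negbTE vY) andbF.
- move=> v vY; have [xv|xv] := x1 v.
    by rewrite xv add0r y1 // !inE vY xv eqxx.
  have nz : x v != 0 by rewrite -normr_gt0 xv.
  by rewrite y0 ?addr0 // !inE nz.
move=> j z; under eq_bigr do rewrite mulrDr.
rewrite big_split /=; apply: le_trans (ler_normD _ _) _.
have := xb j z; have := yb j z; rewrite /bd -natr1 mulrDl mul1r; lra.
Qed.

Lemma balanced_coloring : (#|V| < 2 ^ nu)%N ->
  exists x : V -> R, (forall v, `|x v| = 1) /\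
    forall j z, `|\sum_(e <- take z (o j)) sgn e * x (var e)| <=
      30 * 720 * Num.sqrt 2 ^+ nu.
Proof.
rewrite -cardsT => hV; have [x [_ x1 xb]] := full_coloring (leqnn nu) hV.
exists x; split=> [v|j z]; first by rewrite x1 // inE.
by have := xb j z; rewrite subnn expr0 mulr1.
Qed.

End MultiScale.

(** * Progressions modulo a prime power *)

Fixpoint digit_rev (p K x : nat) : nat :=
  if K is K'.+1 then (x %% p * p ^ K' + digit_rev p K' (x %/ p))%N else 0.

Section DigitReversal.
Variable p : nat.
Hypothesis p0 : (0 < p)%N.

Lemma digit_rev_lt K x : (digit_rev p K x < p ^ K)%N.
Proof.
elim: K x => [|K IH] x //=; rewrite expnS.
by have := IH (x %/ p)%N; have := ltn_pmod x p0; nia.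
Qed.

(* Hence signs alternating along consecutive positions balance every residue class. *)
Lemma digit_rev_block K j x y : (j <= K)%N -> (x < p ^ K)%N -> (y < p ^ K)%N ->
  (x == y %[mod p ^ j]) =
  (digit_rev p K x %/ p ^ (K - j) == digit_rev p K y %/ p ^ (K - j))%N.
Proof.
elim: K j x y => [|K IH] [|j] x y // jK xK yK;
  try by rewrite !modn1 subn0 !divn_small ?digit_rev_lt.
rewrite /= subSS.
have E z : (z %% p * p ^ K + digit_rev p K (z %/ p) =
    (z %% p * p ^ j) * p ^ (K - j) + digit_rev p K (z %/ p))%N.
  by rewrite -mulnA -expnD subnKC.
rewrite !E !divnMDl ?expn_gt0 ?p0 //.
have lt z : (digit_rev p K (z %/ p) %/ p ^ (K - j) < p ^ j)%N.
  by rewrite ltn_divLR ?expn_gt0 ?p0 // -expnD subnKC // digit_rev_lt.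
have dE z : (z %% p ^ j.+1 = (z %/ p) %% p ^ j * p + z %% p)%N.
  by rewrite modn_divl expnSr -(modn_dvdm z (dvdn_mull (p ^ j) (dvdnn p))) -divn_eq.
have dlt z : (z < p ^ K.+1)%N -> (z %/ p < p ^ K)%N.
  by move=> h; rewrite ltn_divLR // mulnC -expnS.
have := IH j (x %/ p)%N (y %/ p)%N jK (dlt _ xK) (dlt _ yK).
rewrite !dE; move: (lt x) (lt y) (ltn_pmod x p0) (ltn_pmod y p0).
move: (x %% p)%N (y %% p)%N (x %/ p %% p ^ j)%N (y %/ p %% p ^ j)%N.
move: (_ %/ _)%N (_ %/ _)%N (p ^ j)%N => u v q a b c d uq vq ap bp H.
have inj (m s t s' t' : nat) : (t < m)%N -> (t' < m)%N ->
    (s * m + t == s' * m + t')%N = (s == s') && (t == t').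
  move=> tm tm'; apply/eqP/andP => [h|[/eqP -> /eqP ->]] //.
  have m0 : (0 < m)%N by case: (m) tm.
  have := congr1 (divn^~ m) h; have := congr1 (modn^~ m) h.
  by rewrite !modnMDl !divnMDl // !modn_small // !divn_small // !addn0 => -> ->.
by rewrite !inj // H andbC.
Qed.

Lemma digit_rev_inj K x y : (x < p ^ K)%N -> (y < p ^ K)%N ->
  digit_rev p K x = digit_rev p K y -> x = y.
Proof.
move=> xK yK E; have := digit_rev_block (leqnn K) xK yK.
by rewrite E eqxx !modn_small // => /eqP.
Qed.

End DigitReversal.

Lemma block_sum (R : nmodType) (F : nat -> R) (g S c : nat) : (c < g)%N -> (0 < S)%N ->
  \sum_(y < g * S | (y %/ S == c)%N) F y = \sum_(t < S) F (c * S + t)%N.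
Proof.
move=> cg S0; rewrite -(big_mkord (fun y => y %/ S == c)%N F).
have le1 : (c * S <= c.+1 * S)%N by rewrite leq_mul2r leqnSn orbT.
have le2 : (c.+1 * S <= g * S)%N by rewrite leq_mul2r cg orbT.
rewrite (big_cat_nat (n := c * S)) ?(leq_trans le1 le2) //=.
rewrite big_nat_cond big1 ?add0r; last first.
  by move=> y /andP[/andP[_ h] /eqP e]; move: h; rewrite -ltn_divLR // e ltnn.
rewrite (big_cat_nat (n := c.+1 * S)) //=.
rewrite [X in _ + X]big_nat_cond [X in _ + X]big1 ?addr0; last first.
  by move=> y /andP[/andP[h _] /eqP e]; move: h; rewrite -leq_divRL // e ltnn.
rewrite -{1}[(c * S)%N]add0n big_addn mulSn addnK big_nat_cond.
rewrite (eq_bigl (fun t => 0 <= t < S)%N); last first.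
  move=> t /=; case: (ltnP t S) => // tS.
  by rewrite addnC divnMDl // divn_small // addn0 eqxx.
rewrite -big_nat big_mkord; apply: eq_bigr => t _; by rewrite addnC.
Qed.

(** * Cycles of a translation in Z_N *)

Section Cycles.
Variables (N d : nat).
Hypothesis N0 : (0 < N)%N.
Notation g := (gcdn d N).
Notation S := (N %/ gcdn d N)%N.

Lemma gS : (g * S = N)%N.
Proof. by rewrite mulnC divnK // dvdn_gcdr. Qed.

Lemma g_gt0 : (0 < g)%N. Proof. by rewrite gcdn_gt0 N0 orbT. Qed.

Lemma S_gt0 : (0 < S)%N. Proof. by rewrite divn_gt0 ?g_gt0 // dvdn_leq // dvdn_gcdr. Qed.

(** Lists Z_N cycle after cycle: place c S + t holds c + t d, the t-th point of the cycle through c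
    < g. *)
Definition cycle_pos (y : nat) : nat := ((y %/ S + y %% S * d) %% N)%N.

Lemma cycle_pos_modg y : (y < N)%N -> (cycle_pos y %% g = y %/ S)%N.
Proof.
move=> yN; rewrite /cycle_pos modn_dvdm ?dvdn_gcdr //.
rewrite -modnDmr (eqP (dvdn_mull _ (dvdn_gcdl d N))) addn0 modn_small //.
by rewrite ltn_divLR ?S_gt0 // gS.
Qed.

(** Since d/g is coprime to S = N/g, N divides (r - s) d only if S divides r - s. *)
Lemma eqmod_mul_dir r s : (r < S)%N -> (s < S)%N ->
  (r * d = s * d %[mod N])%N -> r = s.
Proof.
have dg : (d = d %/ g * g)%N by rewrite divnK // dvdn_gcdl.
have cop : coprime S (d %/ g).
  by rewrite /coprime -(eqn_pmul2r g_gt0) mul1n muln_gcdl -dg mulnC gS gcdnC.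
wlog sr : r s / (s <= r)%N => [H rS sS e|rS _ /eqP].
  by case/orP: (leq_total s r) => le; [exact: H|symmetry; exact: H].
rewrite eqn_mod_dvd ?leq_mul2r ?sr ?orbT // -mulnBl.
rewrite -[X in (X %| _)%N]gS [X in (X %| _)%N]mulnC [X in (_ %| _ * X)%N]dg mulnA.
rewrite dvdn_pmul2r ?g_gt0 // Gauss_dvdl //.
have [/eqP|p0] := posnP (r - s)%N.
  by rewrite subn_eq0 => rs _; apply/eqP; rewrite eqn_leq rs sr.
by move/(dvdn_leq p0); rewrite leqNgt (leq_ltn_trans (leq_subr _ _) rS).
Qed.

Lemma cycle_pos_inj y z : (y < N)%N -> (z < N)%N -> cycle_pos y = cycle_pos z -> y = z.
Proof.
move=> yN zN E; have Ed : (y %/ S = z %/ S)%N by rewrite -!cycle_pos_modg // E.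
rewrite (divn_eq y S) (divn_eq z S) Ed; congr addn.
apply: eqmod_mul_dir; rewrite ?ltn_pmod ?S_gt0 //.
by apply/eqP; rewrite -(eqn_modDl (z %/ S)); move/eqP: E; rewrite /cycle_pos Ed.
Qed.

Lemma cycle_pos_onto a : exists a0 i0, [/\ (a0 < g)%N, (i0 < S)%N &
  (a = a0 + i0 * d %[mod N])%N].
Proof.
have lt (y : 'I_N) : (cycle_pos y < N)%N by rewrite ltn_pmod.
pose f y := Ordinal (lt y).
have fi : injective f.
  by move=> y z /(congr1 val) /= /cycle_pos_inj h; apply/val_inj/h.
have /codomP[y /(congr1 val) /= E] := injF_onto fi (Ordinal (ltn_pmod a N0)).
exists (y %/ S)%N, (y %% S)%N; split; last by [].
  by rewrite ltn_divLR ?S_gt0 // gS.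
by rewrite ltn_pmod // S_gt0.
Qed.

End Cycles.

(** * The colouring of Z_N *)

Section UpperBound.
Variables (R : realType) (p K N' : nat).
Hypotheses (pp : prime p) (hN : N'.+1 = (p ^ K)%N).
Notation N := (N'.+1).

Let p0 : (0 < p)%N := prime_gt0 pp.

Let altsgn (y : nat) : R := if odd y then -1 else 1.
(** [phi] colours positions, x i being the sign of the pair 2i, 2i+1; [psi] carries it to residues
    by digit reversal. *)
Let phi (x : 'I_N -> R) (y : nat) : R := altsgn y * x (inord (y %/ 2)).
Let psi (x : 'I_N -> R) (z : nat) : R := phi x (digit_rev p K (z %% N)).

Let phi_prefix x m : (forall v, `|x v| = 1) -> `|\sum_(y < m) phi x y| <= 1.
Proof.
move=> x1.
have even q : \sum_(y < q.*2) phi x y = 0.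
  elim: q => [|q IH]; first by rewrite big_ord0.
  rewrite doubleS !big_ord_recr /= IH add0r /phi /altsgn /= odd_double /=.
  have -> : (q.*2.+1 %/ 2 = q.*2 %/ 2)%N by rewrite -!muln2; lia.
  by rewrite mul1r mulN1r subrr.
rewrite -(odd_double_half m); case: (odd m); last by rewrite add0n even normr0.
rewrite add1n big_ord_recr /= even add0r /phi /altsgn odd_double mul1r.
by rewrite x1.
Qed.

Let rev_lt z : (digit_rev p K z < N)%N.
Proof. by rewrite hN digit_rev_lt. Qed.

(** The class fills an interval of positions, a difference of two prefixes with sums at most 1. *)
Lemma psi_class_sum x j a : (forall v, `|x v| = 1) -> (j <= K)%N ->
  `|\sum_(e < N | e == a %[mod p ^ j]) psi x e| <= 2.
Proof.
move=> x1 jK; pose f (e : 'I_N) : 'I_N := Ordinal (rev_lt e).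
have fi : injective f.
  move=> e e' /(congr1 val) /= E; apply/val_inj.
  by apply: (digit_rev_inj p0 _ _ E); rewrite -hN; apply: ltn_ord.
pose S := (p ^ (K - j))%N; pose c := (digit_rev p K (a %% N) %/ S)%N.
have NS : (p ^ j * S = N)%N by rewrite hN -expnD subnKC.
have S0 : (0 < S)%N by rewrite expn_gt0 p0.
have cg : (c < p ^ j)%N by rewrite ltn_divLR // NS.
have -> : \sum_(e < N | e == a %[mod p ^ j]) psi x e =
    \sum_(e < N | (f e %/ S == c)%N) phi x (f e).
  apply: eq_big => e; last by rewrite /psi (modn_small (ltn_ord e)).
  rewrite -(modn_dvdm a (_ : p ^ j %| N)%N); last by rewrite -NS dvdn_mulr.
  by rewrite (digit_rev_block p0 jK) // -hN // ltn_pmod.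
have -> : \sum_(e < N | (f e %/ S == c)%N) phi x (f e) =
    \sum_(y < N | (y %/ S == c)%N) phi x y by rewrite [RHS](reindex_inj fi).
have -> : \sum_(y < N | (y %/ S == c)%N) phi x y = \sum_(t < S) phi x (c * S + t)%N.
  by rewrite -(block_sum _ cg S0) NS.
have := phi_prefix (c * S + S) x1; rewrite big_split_ord /= => h.
have := phi_prefix (c * S) x1; move: (\sum_(t < S) _) (\sum_(t < c * S) _) h => u v.
by rewrite !ler_norml; lra.
Qed.

Lemma exists_balanced_psi : exists x : 'I_N -> R, (forall v, `|x v| = 1) /\
  forall d z, (z <= N)%N ->
    `|\sum_(y < z) psi x (cycle_pos N d y)| <= 60 * 720 * Num.sqrt N%:R.
Proof.
pose nu := (trunc_log 2 N).+1.
have [nu1 nu2] : (2 ^ nu.-1 <= N)%N /\ (N < 2 ^ nu)%N.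
  by have /andP[] := trunc_log_bounds (isT : 1 < 2)%N (isT : 0 < N)%N.
pose var (e : 'I_N) : 'I_N := inord (digit_rev p K e %/ 2).
pose sgn (e : 'I_N) := altsgn (digit_rev p K e).
have clt d y : (cycle_pos N d y < N)%N by rewrite ltn_pmod.
pose o (d : 'I_N) := [seq Ordinal (clt d y) | y <- iota 0 N].
have sgn1 e : `|sgn e| <= 1 by rewrite /sgn /altsgn; case: ifP; rewrite ?normrN1 ?normr1.
have uo d : uniq (o d).
  rewrite map_inj_in_uniq ?iota_uniq // => y z; rewrite !mem_iota => yN zN.
  by move/(congr1 val)/cycle_pos_inj; apply.
(* Residues sharing a variable are told apart by the parity of their position. *)
have cov d v : (count (fun e => var e == v) (o d) <= 2)%N.
  rewrite -size_filter -card_bool -(card_uniqP (filter_uniq _ (uo d))).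
  apply: (@leq_card_in _ _ (fun e : 'I_N => odd (digit_rev p K e))) => e e'.
  rewrite !mem_filter => /andP[/eqP ev _] /andP[/eqP e'v _] E.
  have half_lt (u : 'I_N) : (digit_rev p K u %/ 2 < N)%N.
    exact: leq_ltn_trans (leq_div _ _) (rev_lt u).
  have := congr1 val (etrans ev (esym e'v)); rewrite /= !inordK // !divn2 => Eh.
  apply/val_inj; apply: (@digit_rev_inj p p0 K); rewrite -?hN ?ltn_ord //.
  by rewrite -(odd_double_half (digit_rev p K e)) E Eh odd_double_half.
have [||x [x1 xb]] := @balanced_coloring R 'I_N 'I_N 'I_N var sgn o nu sgn1 cov.
- by rewrite card_ord ltnW.
- by rewrite card_ord.
exists x; split=> // d z zN.
have -> : \sum_(y < z) psi x (cycle_pos N d y) =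
    \sum_(e <- take z (o (Ordinal (ltn_pmod d (ltn0Sn N'))))) sgn e * x (var e).
  rewrite -map_take take_iota (minn_idPl zN) big_map.
  rewrite -[z in iota 0 z]subn0 -/(index_iota 0 z) big_mkord; apply: eq_bigr => y _.
  have E : cycle_pos N (d %% N) y = cycle_pos N d y.
    by rewrite /cycle_pos gcdn_modl -modnDmr modnMmr modnDmr.
  by rewrite /psi modn_small ?clt // /phi /sgn /var /= E.
apply: le_trans (xb _ _) _.
suff : Num.sqrt 2 ^+ nu <= 2 * Num.sqrt N%:R :> R by lra.
rewrite -(@ler_pXn2r _ 2) ?nnegrE ?mulr_ge0 ?exprn_ge0 ?sqrtr_ge0 //.
rewrite exprAC sqr_sqrtr // exprMn sqr_sqrtr ?ler0n // -!natrX -natrM ler_nat /nu expnS.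
by move: nu1; rewrite /nu /=; lia.
Qed.

Lemma psi_mod x z w : z = w %[mod N] -> psi x z = psi x w.
Proof. by rewrite /psi => ->. Qed.

(** The progression runs along one cycle from offset i0, so its sum is H(i0 + L) - H(i0). Full turns
    number at most q and cost 2 each; each of the two remaining arcs is a difference of prefixes of
    the order, whence 4 * 60 = 240. *)
Lemma exists_ap_coloring : exists f : nat -> R,
  [/\ forall z, `|f z| = 1, forall z w, z = w %[mod N] -> f z = f w &
      forall a d L q : nat, (L <= q * (N %/ gcdn d N))%N ->
        `|\sum_(i < L) f (a + i * d)%N| <= 2 * q%:R + 240 * 720 * Num.sqrt N%:R].
Proof.
have [x [x1 xb]] := exists_balanced_psi; exists (psi x); split=> [z||a d L q Lq].
- by rewrite /psi /phi normrM x1 mulr1 /altsgn; case: ifP; rewrite ?normrN1 ?normr1.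
- exact: psi_mod.
have [a0 [i0 [a0g i0S aE]]] := cycle_pos_onto d (ltn0Sn N') a.
set B : R := 60 * 720 * Num.sqrt N%:R in xb; set S := (N %/ gcdn d N)%N in i0S Lq.
have S0 : (0 < S)%N by exact: S_gt0.
have gSN : (gcdn d N * S)%N = N := gS N d.
pose h t := psi x (a0 + t * d); pose H m := \sum_(t < m) h t.
have cycle_sum m : (m <= S)%N ->
    \sum_(i < m) psi x (cycle_pos N d (a0 * S + i)) = H m.
  move=> mS; apply: eq_bigr => t _; apply: psi_mod; rewrite /cycle_pos -/S modn_mod.
  have tS : (t < S)%N := leq_trans (ltn_ord t) mS.
  by rewrite divnMDl // modnMDl (divn_small tS) (modn_small tS) addn0.
have H_small m : (m <= S)%N -> `|H m| <= 2 * B.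
  move=> mS; have aS : (a0 * S + m <= N)%N.
    apply: (@leq_trans (a0.+1 * S)); first by rewrite mulSnr leq_add2l.
    by rewrite -[X in (_ <= X)%N]gSN leq_mul2r a0g orbT.
  have := xb d _ aS; rewrite big_split_ord /=.
  have := xb d _ (leq_trans (leq_addr m (a0 * S)) aS).
  rewrite cycle_sum //; move: (\sum_(i < _) _) => u; rewrite !ler_norml; lra.
(* A cycle is a whole residue class modulo g, and g divides p^K, so it is a power of p. *)
have H_full : `|H S| <= 2.
  have [j jK gE] : exists2 j, (j <= K)%N & gcdn d N = (p ^ j)%N.
    by apply/(dvdn_pfactor _ _ pp); rewrite -hN dvdn_gcdr.
  have := psi_class_sum a0 x1 jK; rewrite -gE.
  have clt (y : 'I_N) : (cycle_pos N d y < N)%N by rewrite ltn_pmod.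
  have ci : injective (fun y => Ordinal (clt y)).
    move=> y z /(congr1 val) /= E; apply/val_inj.
    by apply: cycle_pos_inj E => //; exact: ltn_ord.
  rewrite (reindex_inj ci) /=.
  rewrite (eq_bigl (fun y : 'I_N => (y %/ S == a0)%N)); last first.
    by move=> y; rewrite cycle_pos_modg ?ltn_ord // (modn_small a0g).
  have -> : \sum_(y < N | (y %/ S == a0)%N) psi x (cycle_pos N d y) =
      \sum_(y < gcdn d N * S | (y %/ S == a0)%N) psi x (cycle_pos N d y) by rewrite gSN.
  rewrite (block_sum (fun y => psi x (cycle_pos N d y)) a0g S0).
  by rewrite cycle_sum.
have H_per m w : H (w * S + m)%N = w%:R * H S + H m.
  have hp w' t : h (w' * S + t)%N = h t.
    apply: psi_mod; rewrite mulnDl addnA.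
    have -> : (w' * S * d = w' * (d %/ gcdn d N) * N)%N.
      rewrite -[X in (_ = _ * X)%N]gSN -{1}(divnK (dvdn_gcdl d N)); ring.
    by rewrite [(a0 + _)%N]addnC -addnA modnMDl.
  elim: w m => [|w IH] m; first by rewrite mul0r add0r.
  rewrite mulSn -addnA /H big_split_ord /= -/(H S).
  have -> : \sum_(i < w * S + m) h (S + i)%N = H (w * S + m)%N.
    by apply: eq_bigr => t _; rewrite -[in RHS](hp 1%N) mul1n.
  by rewrite IH addrA -natr1 mulrDl mul1r [w%:R * _ + _]addrC.
have -> : \sum_(i < L) psi x (a + i * d) = H (i0 + L)%N - H i0.
  rewrite /H big_split_ord /= [RHS]addrC addKr; apply: eq_bigr => i _.
  by apply: psi_mod; rewrite -modnDml aE modnDml mulnDl addnA.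
apply: le_trans (ler_normB _ _) _.
have h1 := H_small i0 (ltnW i0S).
rewrite {1}(divn_eq (i0 + L) S) H_per.
have h2 := H_small _ (ltnW (ltn_pmod (i0 + L) S0)).
have wq : ((i0 + L) %/ S <= q)%N.
  by rewrite -ltnS ltn_divLR // mulSn -addSn leq_add.
have h3 : `|((i0 + L) %/ S)%:R * H S| <= q%:R * 2.
  by rewrite normrM normr_nat ler_pM // ler_nat.
have := ler_normD (((i0 + L) %/ S)%:R * H S) (H ((i0 + L) %% S)%N).
by rewrite /B in h1 h2; lra.
Qed.

End UpperBound.

(** * The discrepancy *)

(** The bound on l makes the terms distinct, so the sum over the set has no collisions. *)
Lemma chi_sum_ap (m : nat) (chi : {ffun 'I_m.+1 -> bool}) (a d l : nat) :
  (l <= m.+1 %/ gcdn d m.+1)%N ->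
  chi_sum chi (ap m.+1 a d l) =
  \sum_(i < l) (if chi (inZp (a + i * d)) then 1 else -1).
Proof.
move=> hl; pose f (i : 'I_l) : 'I_m.+1 := inZp (a + i * d).
have lm : (l <= m.+1)%N := leq_trans hl (leq_div _ _).
have fi : injective f.
  move=> i j /(congr1 val) /= /eqP; rewrite eqn_modDl => /eqP E; apply/val_inj.
  by apply: (eqmod_mul_dir (isT : 0 < m.+1)%N _ _ E); exact: leq_trans (ltn_ord _) hl.
have -> : ap m.+1 a d l = [set f i | i in setT].
  apply/setP => x; rewrite inE; apply/existsP/imsetP => [[i /andP[il /eqP e]]|[i _ ->]].
    by exists (Ordinal il); rewrite ?inE //; apply/val_inj.
  by exists (inord i); rewrite inordK ?ltn_ord ?eqxx // ltnS ltnW // (leq_trans (ltn_ord i)).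
rewrite /chi_sum big_imset /=; last by move=> i j _ _; exact: fi.
by apply: eq_bigl => i; rewrite inE.
Qed.

Lemma abs_chi_sum_ap (R : realType) (m : nat) (chi : {ffun 'I_m.+1 -> bool}) (a d l : nat) :
  (l <= m.+1 %/ gcdn d m.+1)%N ->
  `|chi_sum chi (ap m.+1 a d l)|%N%:R =
  `|\sum_(i < l) (if chi (inZp (a + i * d)) then 1 else -1)| :> R.
Proof.
move=> hl; rewrite chi_sum_ap // natr_absz intr_norm; congr `|_|.
by rewrite rmorph_sum; apply: eq_bigr => i _ /=; case: (chi _); rewrite ?rmorphN rmorph1.
Qed.

Lemma disc_AP_le (R : realType) (n : nat) (chi : {ffun 'I_n -> bool}) (B : R) : 0 <= B ->
  (forall (a d : 'I_n) (l : 'I_n.+1), ap_ok d l ->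
     `|chi_sum chi (ap n a d l)|%N%:R <= B) ->
  (disc_AP n)%:R <= B.
Proof.
move=> B0 H; apply: (@le_trans _ _ (ap_disc_of chi)%:R).
  by rewrite ler_nat /disc_AP; case: arg_minnP => // chi0 _; apply.
rewrite /ap_disc_of; elim/big_ind: _ => // [x y xB yB|[[a d] l] /= ok]; last exact: H.
by rewrite /maxn; case: ifP.
Qed.

Lemma disc_AP_attained (n : nat) : exists chi : {ffun 'I_n -> bool},
  forall (a d : 'I_n) (l : 'I_n.+1), ap_ok d l ->
    (`|chi_sum chi (ap n a d l)|%N <= disc_AP n)%N.
Proof.
exists [arg min_(chi < [ffun _ => true] : {ffun 'I_n -> bool}) ap_disc_of chi].
rewrite /disc_AP; set chi := arg_min _ _ _ => a d l ok.
exact: (@leq_bigmax_cond _ (fun adl : 'I_n * 'I_n * 'I_n.+1 => ap_ok adl.1.2 adl.2)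
  (fun adl => `|chi_sum chi (ap n adl.1.1 adl.1.2 adl.2)|%N) (a, d, l) ok).
Qed.

Lemma disc_AP_upper (R : realType) (p k : nat) : prime p -> (0 < k)%N ->
  (disc_AP (p ^ k))%:R <= (2 + 240 * 720) * Num.sqrt p%:R ^+ (k - k %/ 3) :> R.
Proof.
move=> pp k0; set l := (k %/ 3)%N; set K := (k - l)%N.
have lk : (l <= k)%N by exact: leq_div.
have p0 := prime_gt0 pp.
have [N' hN] : exists N', N'.+1 = (p ^ K)%N.
  by exists (p ^ K).-1; rewrite prednK // expn_gt0 p0.
have [m hn] : exists m, m.+1 = (p ^ k)%N.
  by exists (p ^ k).-1; rewrite prednK // expn_gt0 p0.
have nE : (m.+1 = p ^ l * N'.+1)%N by rewrite hn hN -expnD subnKC.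
have [f [f1 fmod fb]] := @exists_ap_coloring R p K N' pp hN.
have sp1 : 1 <= Num.sqrt p%:R :> R by rewrite -[leLHS]sqrtr1 ler_wsqrtr // ler1n.
have sN : Num.sqrt N'.+1%:R = Num.sqrt p%:R ^+ K :> R.
  rewrite hN natrX; elim: (K) => [|j IH]; first by rewrite !expr0 sqrtr1.
  by rewrite !exprS sqrtrM ?ler0n // IH.
(* This is 2l <= k - l, from l = floor(k/3). *)
have pl : (p ^ l)%:R <= Num.sqrt p%:R ^+ K :> R.
  rewrite natrX -{1}(sqr_sqrtr (ler0n R p)) -exprM ler_weXn2l // /K /l; lia.
rewrite -hn; apply: (@disc_AP_le _ _ [ffun z : 'I_m.+1 => 0 < f z]).
  by rewrite mulr_ge0 ?exprn_ge0 ?sqrtr_ge0 //; lra.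
move=> a d L ok; rewrite abs_chi_sum_ap //.
have -> : \sum_(i < L) (if [ffun z : 'I_m.+1 => 0 < f z] (inZp (a + i * d)) then 1 else -1) =
   \sum_(i < L) f (a + i * d)%N.
  apply: eq_bigr => i _; rewrite ffunE /=.
  have -> : f ((a + i * d) %% m.+1)%N = f (a + i * d)%N.
    by apply: fmod; rewrite modn_dvdm // nE dvdn_mull.
  have := f1 (a + i * d)%N; case: (ltrP 0 (f _)) => h; first by rewrite gtr0_norm.
  by rewrite ler0_norm // => <-; rewrite opprK.
(* At most q = p^l turns: gcd(d, N) divides gcd(d, n), so n/gcd(d, n) <= p^l N/gcd(d, N). *)
apply: le_trans (fb a d L (p ^ l)%N _) _; last by rewrite sN; lra.
apply: leq_trans ok _; rewrite muln_divA ?dvdn_gcdr // -nE leq_div2l //.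
  by rewrite gcdn_gt0 orbT.
rewrite dvdn_leq ?gcdn_gt0 ?orbT // dvdn_gcd dvdn_gcdl /=.
by apply: dvdn_trans (dvdn_gcdr _ _) _; rewrite nE dvdn_mull.
Qed.

Lemma disc_AP_lower (R : realType) (p k : nat) : prime p -> (0 < k)%N ->
  1 / 128 * Num.sqrt p%:R ^+ (k - k %/ 3) <= (disc_AP (p ^ k))%:R :> R.
Proof.
move=> pp k0; set l := (k %/ 3)%N; set D : R := (disc_AP _)%:R.
have p0 := prime_gt0 pp.
have lk : (l < k)%N by rewrite ltn_divLR //; lia.
have [m hn] : exists m, m.+2 = (p ^ k)%N.
  have : (1 < p ^ k)%N by rewrite -(expn0 p) ltn_exp2l // prime_gt1.
  by case: (p ^ k)%N => // -[|m] // _; exists m.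
have sp1 : 1 <= Num.sqrt p%:R :> R by rewrite -[leLHS]sqrtr1 ler_wsqrtr // ler1n.
have [chi hchi] := disc_AP_attained m.+2.
have D0 : 0 <= D by exact: ler0n.
have [small|large] := lerP (2 * D) (p ^ l.+1)%:R; last first.
  (* Here D > P/2 already suffices, because k - l <= 2(l + 1). *)
  suff : Num.sqrt p%:R ^+ (k - l) <= (p ^ l.+1)%:R :> R by lra.
  rewrite natrX -{2}(sqr_sqrtr (ler0n R p)) -exprM ler_weXn2l // /l; lia.
have := @lower_core R m p k l pp hn lk (fun x => if chi x then 1 else -1) D _ _ small.
move=> H; have {}H : (p ^ (k - l))%:R <= 8192 * D ^+ 2.
  apply: H => [x|a d L hL]; first by case: (chi x); rewrite ?normrN1 ?normr1.
  have Ln : (L < m.+3)%N by rewrite ltnS (leq_trans hL) ?leq_div.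
  have := hchi a d (Ordinal Ln) hL; rewrite -(ler_nat R) abs_chi_sum_ap // /D -hn.
  congr (`|_| <= _); apply: eq_bigr => i _; congr (if chi _ then _ else _).
  by apply/val_inj; rewrite /= val_natmul modnDmr.
suff : Num.sqrt p%:R ^+ (k - l) <= 128 * D by lra.
rewrite -(@ler_pXn2r _ 2) ?nnegrE ?mulr_ge0 ?exprn_ge0 ?sqrtr_ge0 //.
rewrite exprAC sqr_sqrtr ?ler0n // -natrX; apply: le_trans H _.
by have := sqr_ge0 D; nra.
Qed.

(* p^((k - floor(k/3))/2) = (sqrt p)^(k - floor(k/3)) *)
Theorem theorem1p2 (R : realType) :
  exists c1 c2 : R, 0 < c1 /\ 0 < c2 /\
    forall p k : nat, prime p -> (0 < k)%N ->
      c1 * Num.sqrt (p%:R) ^+ (k - k %/ 3) <= (disc_AP (p ^ k))%:R /\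
      (disc_AP (p ^ k))%:R <= c2 * Num.sqrt (p%:R) ^+ (k - k %/ 3).
Proof.
exists (1 / 128), (2 + 240 * 720); split; first by lra.
split; first by lra.
by move=> p k pp k0; split; [exact: disc_AP_lower|exact: disc_AP_upper].
Qed.
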